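(* Let $A$ and $B$ be bounded subsets of $\mathbb{R}$ with $D_B\le D_A$, where $D_A=\mathrm{diam}(A)$, $D_B=\mathrm{diam}(B)$, and suppose $$\lambda(A+B)=D_B+\lambda(A)<\lambda(A)+2\lambda(B).$$ Put $A'=A-\inf(A)$ and $B'=B-\inf(B)$. Then there exist positive real numbers $b,c$ with $b,c\le D_B$ such that the interval $I=(b,D_A-c)$ has length at least $\lambda(A)+\lambda(B)-D_B$ and, writing $A_1=A'\cap[0,b]$ and $A_2=D_A-(A'\cap[D_A-c,D_A])$, the following hold up to sets of Lebesgue measure $0$: \begin{itemize} \item $A'\cap[0,b]=(A'+B')\cap[0,b]$; \item $(A'+B')\cap[D_A+D_B-c,\,D_A+D_B]=D_A+D_B-A_2$; \item $I\subset A'$; \item $(b,D_A+D_B-c)\subset A'+B'$; \item $A'=A_1\cup I\cup(D_A-A_2)$ and $A'+B'=A_1\cup(b,D_A+D_B-c)\cup(D_A+D_B-A_2)$. \end{itemize} Furthermore, up to sets of measure $0$, $B'$ is a disjoint union $B'=B_1\cup B_I\cup(D_B-B_2)$ of three sets such that \begin{itemize} \item $B_1\subset A_1$, $B_2\subset A_2$, $B_I\subset(b,D_B-c)$; \item $\lambda(B_1\cap[0,x])\le x^2/c_1$ for all $0< x\le c_1$, where $c_1=\sup\{x : \lambda(A'\cap[0,x])\le \tfrac12 x\}$; \item $\lambda(B_2\cap[0,x])\le x^2/c_2$ for all $0< x\le c_2$, where $c_2=\sup\{x : \lambda(A'\cap(D_A-x,D_A))\le \tfrac12 x\}$. \end{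itemize}
   Context: $\lambda$ denotes the inner Lebesgue measure on $\mathbb{R}$; for a bounded set $S\subset\mathbb{R}$, $\mathrm{diam}(S)=\sup(S)-\inf(S)$. For $t\in\mathbb{R}$ and $X\subset\mathbb{R}$, $t-X=\{t-x:x\in X\}$ and $t+X=\{t+x:x\in X\}$. The first two bulleted items are what the paper phrases as ''$A_1$ is $B'$-stable'' and ''$A_2$ is $B'$-stable'' (the latter understood after the reflection $x\mapsto D_A+D_B-x$).
   Formalization: b, c are only nonnegative, and positive when λ(B)<D_B (A=B=[0,1] forces b=c=0); the suprema defining c_1, c_2 run over 0≤x≤D_A (otherwise infinite); ''up to measure 0'' means that the differences have inner measure λ equal to 0. *)

(* Defs.v *)
From HB Require Import structures.
From mathcomp Require Import all_boot all_order all_algebra.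
From mathcomp Require Import all_classical all_reals all_analysis.
Set Implicit Arguments.
Unset Strict Implicit.
Unset Printing Implicit Defensive.
Import Order.TTheory GRing.Theory Num.Theory.
Import numFieldNormedType.Exports.
Local Open Scope classical_set_scope.
Local Open Scope ring_scope.

Definition inner_lebesgue (R : realType) (S : set R) : \bar R :=
  ereal_sup [set (@lebesgue_measure R) K | K in [set K | compact K /\ K `<=` S]].

Definition diam (R : realType) (S : set R) : R := sup S - inf S.

Definition sumset (R : realType) (X Y : set R) : set R :=
  [set x + y | x in X & y in Y].

Definition translate (R : realType) (t : R) (X : set R) : set R :=
  [set t + x | x in X].

Definition reflect_at (R : realType) (t : R) (X : set R) : set R :=
  [set t - x | x in X].

(* Null sets are those of inner measure 0. Outer measure would be the wrong
   notion here: even for measurable X and Y the sumset of X and Y need not be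
   measurable. Since inner null sets are not closed under unions, the two
   differences in null_eq are bounded separately and not through the symmetric
   difference; for measurable sets this is the usual equality up to a null set. *)
Definition null_sub (R : realType) (X Y : set R) : Prop :=
  inner_lebesgue (X `\` Y) = 0%E.

Definition null_eq (R : realType) (X Y : set R) : Prop :=
  null_sub X Y /\ null_sub Y X.

(* The constants c_1 and c_2 for a set X contained in [0, D]. The range of x
   must be limited to [0, D]: every x >= 2 * inner_lebesgue X satisfies the
   inequality, so that the supremum over all reals would be infinite. *)
Definition left_half_radius (R : realType) (D : R) (X : set R) : R :=
  sup [set x : R | 0 <= x <= D /\
    (inner_lebesgue (X `&` `[0%R, x]) <= (x / 2)%:E)%E].

Definition right_half_radius (R : realType) (D : R) (X : set R) : R :=
  sup [set x : R | 0 <= x <= D /\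
    (inner_lebesgue (X `&` `](D - x)%R, D[) <= (x / 2)%:E)%E].

(* Main.v *)
(** Up to null sets, [A] and [B] may be replaced by sigma-compact subsets of full inner measure
    with their end points added: the sumset does not grow, because a compact set outside the
    sumset cannot have arbitrarily small translates inside it. Reduce [A + B] modulo [D_A]: the
    two parts overlap in a set containing [B], so Raikov's inequality on the circle (obtained
    from Cauchy-Davenport by discretization) gives [D_A + m(B) <= m(A) + D_B]; hence the
    complement [C] of [A] in [[0, D_A]] satisfies [m(C) < m(B)]. A hole [s] of [A + B] reflects
    [B] into [C]. Therefore the holes lie in [E] and [D_A + F] with [E] and [F] inside
    [[0, D_B]], the set [C] is [E] together with [F + D_A - D_B] up to a null set, and every
    element of [E] is below every element of [F]. One takes [b = sup E] and [c = D_B - inf F];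
    if one of the two vanishes and the other one is extremal, then the density of [B] on
    windows is monotone unless there is some room at the end of [E], and the Lebesgue density
    theorem would make [B] full.

    For the quadratic bound, let [x] be in [B] with [m(B cap [0, x]) >= x^2 / c_1]. Raikov's
    inequality modulo [x] shows that the measure of [A] in the successive intervals of length
    [x] increases by [x^2 / c_1] at each step, so [A] would fill more than half of
    [[0, c_1]]. *)
Require Import Defs.
From HB Require Import structures.
From mathcomp Require Import all_boot all_order all_algebra.
From mathcomp Require Import all_classical all_reals all_analysis.
From mathcomp Require Import measurable_realfun ring lra zify.
Import Order.TTheory GRing.Theory Num.Theory.
Import numFieldNormedType.Exports.
Local Open Scope classical_set_scope.
Local Open Scope ring_scope.

Set Implicit Arguments.
Unset Strict Implicit.
Unset Printing Implicit Defensive.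

(** * Real-valued Lebesgue measure *)

(** The obstacle is that A + B need not be measurable and that inner null sets are not closed under
    unions. The subsets are taken sigma-compact because their sumset is then measurable as well. The
    end points have to be genuine elements: E lies outside A because 0 is in B, and F + D_A - D_B
    lies outside A because D_B is in B.

    Put M = m(C) + D_B - m(B); the bound b + c <= M is exactly the required length of I. If m(B) =
    D_B, then m(C) = 0 and this length leaves only b = c = 0, so positivity is claimed for m(B) <
    D_B. It is delicate only if one side has no holes and the holes of the other side reach M.
    Reflection in M then exchanges B and C with equality of measure on windows; reflection in a hole
    e < M followed by reflection in M is the translation by M - e, and this is why the windows of B
    become denser to the right. *)

Section RealMeasure.
Variable R : realType.
Implicit Types (X Y Z N : set R) (t x y a b e : R).

Local Notation mu := (@lebesgue_measure R).

(** Preimages rather than images: membership unfolds by computation and measurability is that of an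
    affine map. [translateE] and [reflect_atE] identify them with the images used in the
    statement. *)
Definition shift_set t X : set R := [set x | X (x - t)].
Definition flip_set t X : set R := [set x | X (t - x)].
Definition rmeas X : R := fine (mu X).
Definition finmeas X : Prop := measurable X /\ (mu X < +oo)%E.

Lemma measurable_shift t X : measurable X -> measurable (shift_set t X).
Proof.
move=> mX; rewrite (_ : shift_set t X = setT `&` (fun x => x - t) @^-1` X); last first.
  by rewrite setTI.
apply: (_ : measurable_fun setT (fun x : R => x - t)) => //.
exact: measurable_funB.
Qed.

Lemma measurable_flip t X : measurable X -> measurable (flip_set t X).
Proof.
move=> mX; rewrite (_ : flip_set t X = setT `&` (fun x => t - x) @^-1` X); last first.
  by rewrite setTI.
apply: (_ : measurable_fun setT (fun x : R => t - x)) => //.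
exact: measurable_funB.
Qed.

(** The push-forward under a translation agrees with Lebesgue measure on half-open intervals, and
    these determine it. *)
Lemma mu_shift t X : measurable X -> mu (shift_set t X) = mu X.
Proof.
move=> mX; rewrite -[LHS]/(pushforward mu ((fun x => x - t) : _ -> measurableTypeR R) X).
apply/esym/lebesgue_measure_unique => //=; first exact: measurable_funB.
move=> _ _ [[a b]] _ <-; rewrite /pushforward.
rewrite (_ : _ @^-1` _ = `]a + t, b + t]%classic); last first.
  by apply/seteqP; split => x /=; rewrite !in_itv/= ltrBrDr lerBlDr.
rewrite !lebesgue_measure_itv/= !lte_fin ltrD2r.
by case: ifP => // _; rewrite -!EFinB; congr (_%:E); rewrite opprD addrACA subrr addr0.
Qed.

Lemma mu_flip t X : measurable X -> mu (flip_set t X) = mu X.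
Proof.
move=> mX; have mtX := @measurable_shift (- t) _ mX.
rewrite -[RHS](mu_shift (- t)) // -[RHS]lebesgue_measureN // /pushforward.
rewrite (_ : flip_set t X = -%R @^-1` shift_set (- t) X) //.
by apply/seteqP; split => x; rewrite /shift_set /flip_set /= opprK addrC.
Qed.

Lemma finmeasI X Y : finmeas X -> measurable Y -> finmeas (X `&` Y).
Proof.
move=> [mX fX] mY; split; first exact: measurableI.
by apply: le_lt_trans fX; apply: le_measure; rewrite ?inE //; exact: measurableI.
Qed.

Lemma finmeas_sub X Y : measurable X -> finmeas Y -> X `<=` Y -> finmeas X.
Proof. by move=> mX fY /setIidr <-; exact: finmeasI. Qed.

Lemma finmeasU X Y : finmeas X -> finmeas Y -> finmeas (X `|` Y).
Proof.
move=> [mX fX] [mY fY]; split; first exact: measurableU.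
by apply: le_lt_trans (lte_add_pinfty fX fY); exact: measureU2.
Qed.

Lemma finmeasD X Y : finmeas X -> measurable Y -> finmeas (X `\` Y).
Proof. by move=> fX mY; rewrite setDE; apply: finmeasI => //; exact: measurableC. Qed.

Lemma finmeas_shift t X : finmeas X -> finmeas (shift_set t X).
Proof. by move=> [mX fX]; split; [exact: measurable_shift|rewrite mu_shift]. Qed.

Lemma finmeas_flip t X : finmeas X -> finmeas (flip_set t X).
Proof. by move=> [mX fX]; split; [exact: measurable_flip|rewrite mu_flip]. Qed.

Lemma finmeas_itv (a b : bool) x y : finmeas [set` Interval (BSide a x) (BSide b y)].
Proof.
split; first exact: measurable_itv.
by rewrite lebesgue_measure_itv/=; case: ifP => _ //; rewrite -EFinB ltry.
Qed.

Lemma finmeas_compact X : compact X -> finmeas X.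
Proof. by move=> cX; split; [exact: compact_measurable|exact: compact_finite_measure]. Qed.

Lemma rmeasE X : finmeas X -> mu X = (rmeas X)%:E.
Proof. by move=> [mX fX]; rewrite fineK // ge0_fin_numE. Qed.

Lemma rmeas_ge0 X : 0 <= rmeas X.
Proof. exact: fine_ge0. Qed.

Lemma rmeas0 : rmeas set0 = 0.
Proof. by rewrite /rmeas measure0. Qed.

Lemma rmeas_le X Y : finmeas Y -> measurable X -> X `<=` Y -> rmeas X <= rmeas Y.
Proof.
move=> fY mX XY; rewrite -lee_fin -!rmeasE //; last exact: finmeas_sub fY XY.
by apply: le_measure; rewrite ?inE //; case: fY.
Qed.

Lemma rmeasID X Y : finmeas X -> measurable Y ->
  rmeas X = rmeas (X `&` Y) + rmeas (X `\` Y).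
Proof.
move=> fX mY; apply: EFin_inj; rewrite EFinD -!rmeasE //; first last.
- exact: finmeasI.
- exact: finmeasD.
by rewrite addeC; apply: measureDI => //; case: fX.
Qed.

Lemma rmeasUI X Y : finmeas X -> finmeas Y ->
  rmeas (X `|` Y) + rmeas (X `&` Y) = rmeas X + rmeas Y.
Proof.
move=> fX fY; have [mX _] := fX; have [mY _] := fY.
rewrite (@rmeasID (X `|` Y) X) //; last exact: finmeasU.
have -> : (X `|` Y) `&` X = X by apply/seteqP; split => x /=; tauto.
have -> : (X `|` Y) `\` X = Y `\` X by rewrite setDUl setDv set0U.
by rewrite (@rmeasID Y X) // (setIC Y X); lra.
Qed.

Lemma rmeasU_le X Y : finmeas X -> finmeas Y -> rmeas (X `|` Y) <= rmeas X + rmeas Y.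
Proof. by move=> fX fY; have := rmeasUI fX fY; have := rmeas_ge0 (X `&` Y); lra. Qed.

Lemma rmeasU_disj X Y : finmeas X -> finmeas Y -> (forall x, X x -> Y x -> False) ->
  rmeas (X `|` Y) = rmeas X + rmeas Y.
Proof.
move=> fX fY XY; rewrite -rmeasUI // (_ : X `&` Y = set0) ?rmeas0 ?addr0//.
by apply/seteqP; split => x //= -[] Xx Yx; case: (XY x).
Qed.

Lemma rmeas_shift t X : measurable X -> rmeas (shift_set t X) = rmeas X.
Proof. by move=> mX; rewrite /rmeas mu_shift. Qed.

Lemma rmeas_flip t X : measurable X -> rmeas (flip_set t X) = rmeas X.
Proof. by move=> mX; rewrite /rmeas mu_flip. Qed.

Lemma rmeas_itv (a b : bool) x y : x <= y -> rmeas [set` Interval (BSide a x) (BSide b y)] = y - x.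
Proof.
move=> xy; rewrite /rmeas lebesgue_measure_itv /= lte_fin; case: ltP => // yx.
by rewrite (_ : x = y) ?subrr //=; apply/eqP; rewrite eq_le xy.
Qed.

Lemma rmeas_sub_itv (a b : bool) x y X : x <= y -> measurable X ->
  X `<=` [set` Interval (BSide a x) (BSide b y)] -> rmeas X <= y - x.
Proof. by move=> xy mX sX; rewrite -(rmeas_itv a b) //; apply: rmeas_le => //; exact: finmeas_itv. Qed.

Lemma rmeas_set1 x : rmeas [set x] = 0.
Proof. by rewrite /rmeas lebesgue_measure_set1. Qed.

Lemma finmeas_set1 x : finmeas [set x].
Proof. by split => //; rewrite lebesgue_measure_set1. Qed.

Lemma rmeas_null_le X Y : finmeas X -> finmeas Y -> rmeas (X `\` Y) = 0 -> rmeas X <= rmeas Y.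
Proof.
move=> fX fY XY; have [mX _] := fX; have [mY _] := fY.
rewrite (@rmeasID X Y) // XY addr0; apply: rmeas_le => //; exact: measurableI.
Qed.

Lemma rmeas_gt0_ex X : 0 < rmeas X -> exists x, X x.
Proof.
move=> X0; apply/not_existsP => nX; move: X0.
by rewrite (_ : X = set0) ?rmeas0 ?ltxx //; apply/seteqP; split => x // /nX.
Qed.

Lemma rmeas_inner X e : finmeas X -> 0 < e ->
  exists K : set R, [/\ compact K, K `<=` X & rmeas X < rmeas K + e].
Proof.
move=> fX e0; have [mX lX] := fX.
have [K [cK KX KXe]] := lebesgue_regularity_inner mX lX e0.
have mK : measurable K := compact_measurable cK.
have fXK : finmeas (X `\` K) by exact: finmeasD.
exists K; split => //; rewrite (@rmeasID X K) // setIidr // ltrD2l.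
by rewrite -lte_fin -rmeasE.
Qed.

Lemma rmeas_outer X e : finmeas X -> 0 < e ->
  exists U : set R, [/\ open U, X `<=` U, finmeas (U `\` X) & rmeas (U `\` X) < e].
Proof.
move=> fX e0; have [mX lX] := fX.
have [U [oU XU UX]] := lebesgue_regularity_outer mX lX e0.
have fU : finmeas (U `\` X).
  split; first by apply: measurableD => //; exact: open_measurable.
  by apply: lt_trans UX _; rewrite ltry.
by exists U; split => //; rewrite -lte_fin -rmeasE.
Qed.

End RealMeasure.

(* The goals are matched syntactically: plain unification would unfold a shifted
   difference to an intersection. *)
Ltac msr := repeat first
  [ assumption
  | match goal with H : finmeas ?X |- 'measurable ?X => exact: H.1 end
  | lazymatch goal with
    | |- measurable [set` _] => exact: measurable_itv
    | |- measurable [set _] => exact: measurable_set1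
    | |- measurable (_ `&` _) => apply: measurableI
    | |- measurable (_ `|` _) => apply: measurableU
    | |- measurable (_ `\` _) => apply: measurableD
    | |- measurable (shift_set _ _) => apply: measurable_shift
    | |- measurable (flip_set _ _) => apply: measurable_flip
    end ].
Ltac fmsr := repeat first
  [ assumption
  | lazymatch goal with
    | |- finmeas [set` _] => exact: finmeas_itv
    | |- finmeas [set _] => exact: finmeas_set1
    | |- finmeas (_ `&` _) => apply: finmeasI
    | |- finmeas (_ `|` _) => apply: finmeasU
    | |- finmeas (_ `\` _) => apply: finmeasD
    | |- finmeas (shift_set _ _) => apply: finmeas_shift
    | |- finmeas (flip_set _ _) => apply: finmeas_flip
    end
  | progress msr ].

(** * Null sets, and images as preimages *)

Section NullSets.
Variable R : realType.
Implicit Types (X Y Z N : set R) (t : R).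

Lemma rmeas_null_sub Y Z : finmeas Y -> measurable Z -> rmeas Y = 0 -> Z `<=` Y -> rmeas Z = 0.
Proof. by move=> fY mZ Y0 ZY; apply/eqP; rewrite eq_le rmeas_ge0 andbT -Y0; exact: rmeas_le. Qed.

Lemma rmeas_nullU Y Z : finmeas Y -> finmeas Z -> rmeas Y = 0 -> rmeas Z = 0 ->
  rmeas (Y `|` Z) = 0.
Proof.
move=> fY fZ Y0 Z0; apply/eqP; rewrite eq_le rmeas_ge0 andbT.
by have := rmeasU_le fY fZ; rewrite Y0 Z0 addr0.
Qed.

Lemma rmeas_add_null X N : finmeas X -> finmeas N -> rmeas N = 0 -> rmeas (X `|` N) = rmeas X.
Proof.
move=> fX fN N0; apply/eqP; rewrite eq_le; apply/andP; split.
  by have := rmeasU_le fX fN; rewrite N0 addr0.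
by apply: rmeas_le; [fmsr|msr|move=> x; left].
Qed.

Lemma rmeas_eq_null X Y N : finmeas X -> finmeas Y -> finmeas N -> rmeas N = 0 ->
  X `<=` Y `|` N -> Y `<=` X `|` N -> rmeas X = rmeas Y.
Proof.
move=> fX fY fN N0 XY YX; apply/eqP; rewrite eq_le; apply/andP; split.
  by rewrite -(rmeas_add_null fY fN N0); apply: rmeas_le; [fmsr|msr|].
by rewrite -(rmeas_add_null fX fN N0); apply: rmeas_le; [fmsr|msr|].
Qed.

Lemma translateE t X : translate t X = shift_set t X.
Proof.
apply/seteqP; split => x /=; first by case=> y Xy <-; rewrite /shift_set /= addrC addKr.
by move=> Xx; exists (x - t) => //; rewrite addrC subrK.
Qed.

Lemma reflect_atE t X : reflect_at t X = flip_set t X.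
Proof.
apply/seteqP; split => x /=; first by case=> y Xy <-; rewrite /flip_set /= opprB addrC subrK.
by move=> Xx; exists (t - x) => //; rewrite opprB addrC subrK.
Qed.

End NullSets.

(** * Raikov's inequality on the circle *)

(** Induction on [#|B|] by Dyson's transform: the elements of [B] whose translate by [e] leaves [A]
    are moved, translated, into [A]. The total size is kept, and so are the sums in [C]: for [b]
    moved and [y] kept, [(b + e) + y = b + (y + e)] with [y + e] in [A]. If no transform shrinks
    [B], then [A] is invariant under a nonzero difference, which generates the group. *)
Lemma cauchy_davenport (p : nat) (A B C : {set 'F_p}) : prime p ->
  (0 < #|A|)%N -> (0 < #|B|)%N ->
  (forall a b, a \in A -> b \in B -> a + b \in C) ->
  (minn p (#|A| + #|B|).-1 <= #|C|)%N.
Proof.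
move=> pp; have [n] := ubnP #|B|; elim: n => // n IH in A B *; rewrite ltnS => Bn A0 B0 ABC.
have AC b : b \in B -> (#|A| <= #|C|)%N.
  move=> Bb; rewrite -(card_imset A (addIr b)); apply: subset_leq_card.
  by apply/fintype.subsetP => _ /imsetP[a Aa ->]; exact: ABC.
have [[a [b0 [b1 [Aa Bb0 Bb1 nA]]]]|stable] := pselect (exists a b0 b1,
    [/\ a \in A, b0 \in B, b1 \in B & b1 + (a - b0) \notin A]).
  (* This [e] keeps [b0] and moves [b1], so [B'] is nonempty and strictly smaller than [B]. *)
  pose e := a - b0; pose B' := [set b in B | b + e \in A]%SET.
  have B'B : B' \subset B by apply/fintype.subsetP => x; rewrite inE => /andP[].
  pose A' := A :|: [set b + e | b in B :\: B']%SET.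
  have cA' : #|A'| = (#|A| + (#|B| - #|B'|))%N.
    rewrite cardsU (_ : A :&: _ = finset.set0) ?cards0 ?subn0.
      by rewrite card_imset ?cardsDS //; exact: addIr.
    apply/finset.setP => x; rewrite !inE; apply/negbTE/andP => -[Ax /imsetP[b]].
    by rewrite !inE => /andP[/nandP[/negP//|/negP nb] bB] xE; apply: nb; rewrite -xE.
  have B'lt : (#|B'| < #|B|)%N.
    apply: proper_card; apply/properP; split => //; exists b1 => //.
    by rewrite inE Bb1 /=.
  have B'0 : (0 < #|B'|)%N.
    by apply/card_gt0P; exists b0; rewrite inE Bb0 /= /e addrC subrK.
  have -> : (#|A| + #|B| = #|A'| + #|B'|)%N by rewrite cA'; lia.
  apply: IH => //; first by lia.
    by rewrite cA'; lia.
  move=> x y; rewrite !inE => xA' /andP[By yA].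
  case/orP: xA' => [Ax|/imsetP[b]]; first exact: ABC.
  rewrite !inE => /andP[_ bB] ->; rewrite -addrA (addrC b) (addrC e) ; exact: ABC.
have st a b0 b1 : a \in A -> b0 \in B -> b1 \in B -> a + (b1 - b0) \in A.
  move=> Aa Bb0 Bb1; apply: contrapT => /negP nA; apply: stable.
  by exists a, b0, b1; split => //; rewrite addrCA.
have [b0 Bb0] := card_gt0P B0; have [a Aa] := card_gt0P A0.
have [B1|B2] := leqP #|B| 1.
  by apply: leq_trans (geq_minr _ _) _; apply: leq_trans (AC _ Bb0); lia.
have /card_gt0P[b1] : (0 < #|B :\ b0|)%N by move: (cardsD1 b0 B); rewrite Bb0; lia.
rewrite !inE => /andP[b10 Bb1].
have stk k x : x \in A -> x + (b1 - b0) *+ k \in A.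
  by move=> Ax; elim: k => [|k IHk]; rewrite ?mulr0n ?addr0 // mulrSr addrA; exact: st.
have AT : #|A| = p.
  rewrite -[RHS](card_Fp pp); apply: eq_card => x; rewrite [RHS]inE.
  have d0 : b1 - b0 != 0 by rewrite subr_eq0.
  rewrite -(subrK a x) addrC -[x - a](mulfVK d0) -[_ / _]natr_Zp mulr_natl; exact: stk.
apply: leq_trans (geq_minl _ _) _; apply: leq_trans (AC _ Bb0).
by apply: eq_leq; rewrite AT.
Qed.

Section Raikov.
Variable R : realType.
Implicit Types (X Y Z T K L U : set R) (D h e x y t : R).

Lemma compact_uniform_nbhs K U : compact K -> open U -> K `<=` U ->
  exists2 d : R, 0 < d & forall x y, K x -> `|y - x| < d -> U y.
Proof.
move=> cK oU KU.
have /compact_near_coveringP cov := cK.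
have := cov _ (0 : R)^'+ (fun r x => forall y, `|y - x| < r -> U y) _.
case.
  move=> x Kx; have := open_nbhs_nbhs (conj oU (KU _ Kx)).
  rewrite nbhs_ballP => -[e /= e0 xe].
  exists (ball x (e / 2), `]0, e / 2[%classic) => /=.
    split; first by apply: nbhsx_ballx; rewrite divr_gt0.
    by exists (e / 2) => /=; [rewrite divr_gt0|move=> r /= re r0; rewrite in_itv/= r0 /=;
      move: re; rewrite sub0r normrN gtr0_norm].
  move=> [x' r] /= [xx'] ; rewrite in_itv /= => /andP[r0 re] y yx'; apply: xe.
  move: xx'; rewrite /ball /= => xx'.
  by rewrite (le_lt_trans (ler_distD x' _ _)) // (splitr e) ltrD // distrC (lt_trans yx').
move=> d /= d0 dP; exists (d / 2); first by rewrite divr_gt0.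
move=> x y Kx; apply: (dP (d / 2)) => //=; last by rewrite divr_gt0.
by rewrite sub0r normrN gtr0_norm ?divr_gt0 // ltr_pdivrMr // ltr_pMr // ltr1n.
Qed.

Lemma compact_sumset K L : compact K -> compact L -> compact (sumset K L).
Proof.
move=> cK cL; rewrite (_ : sumset K L = (fun z : R * R => z.1 + z.2) @` (K `*` L)).
  apply: continuous_compact; last exact: compact_setX.
  by apply: continuous_subspaceT => z; apply: cvgD; [exact: cvg_fst|exact: cvg_snd].
apply/seteqP; split => x /=.
  by case=> a Ka [b Lb] <-; exists (a, b).
by case=> -[a b] [/= Ka Lb] <-; exists a => //; exists b.
Qed.

Lemma rmeas_cells Z h n : finmeas Z -> 0 <= h ->
  rmeas (Z `&` `[0, h *+ n[) = \sum_(i < n) rmeas (Z `&` `[h *+ i, h *+ i.+1[).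
Proof.
move=> fZ h0; elim: n => [|n IH]; rewrite ?big_ord_recr ?big_ord0 /=.
  by rewrite mulr0n set_itvco0 setI0 rmeas0.
rewrite -IH -rmeasU_disj; [|by fmsr..|].
  congr rmeas; rewrite -setIUr; congr (_ `&` _).
  have hn : 0 <= h *+ n by rewrite mulrn_wge0.
  apply/seteqP; split => x /=; rewrite !in_itv /= mulrSr; last lra.
  by have [] := ltP x (h *+ n); lra.
by move=> x /= [_]; rewrite !in_itv /= => ? [_] ; lra.
Qed.

(** The sets represent subsets of the circle of length [D]. Cut it into [p] equal cells, [p] a large
    prime, and apply [cauchy_davenport] to the cells that meet compact parts of [X] and [Y]: the sum
    of two such cells lies in a small open neighbourhood of [T]. *)
Lemma raikov D X Y T : 0 < D -> measurable X -> measurable Y -> measurable T ->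
  X `<=` `[0, D[ -> Y `<=` `[0, D[ -> T `<=` `[0, D[ -> X !=set0 -> Y !=set0 ->
  (forall x y, X x -> Y y -> T (x + y) \/ T (x + y - D)) ->
  Num.min D (rmeas X + rmeas Y) <= rmeas T.
Proof.
move=> D0 mX mY mT XD YD TD [x0 Xx0] [y0 Yy0] XYT.
have fD : finmeas (`[0, D[%classic : set R) by fmsr.
have [fX fY fT] := And3 (finmeas_sub mX fD XD) (finmeas_sub mY fD YD) (finmeas_sub mT fD TD).
(* Five errors of size [e]: the inner approximations of [X] and [Y], the outer approximation of [W],
   counted twice when folded back into [[0, D[], and the one cell lost in Cauchy-Davenport. *)
apply/ler_addgt0Pr => e1 e10; pose e := e1 / 5; have e0 : 0 < e by rewrite divr_gt0.
(* The prescribed point keeps the compact part nonempty even when [Z] is null. *)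
have approx Z z0 : finmeas Z -> Z z0 ->
    exists K : set R, [/\ compact K, K `<=` Z, K z0 & rmeas Z < rmeas K + e].
  move=> fZ Zz0; have [K [cK KZ Ke]] := rmeas_inner fZ e0.
  have cK1 : compact (K `|` [set z0]) by apply: compactU => //; exact: compact_set1.
  exists (K `|` [set z0]); split => //; [by move=> x [/KZ|->]|by right|].
  apply: lt_le_trans Ke _; rewrite lerD2r; apply: rmeas_le => //.
  - exact: finmeas_compact.
  - exact: compact_measurable.
have [K [cK KX Kx0 Ke]] := approx _ _ fX Xx0.
have [L [cL LY Ly0 Le]] := approx _ _ fY Yy0.
have [fK fL] := (finmeas_compact cK, finmeas_compact cL).
pose W := T `|` shift_set D T.
have fW : finmeas W by rewrite /W; fmsr.
have [U [oU WU fUW Ue]] := rmeas_outer fW e0.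
have [d d0 dU] : exists2 d : R, 0 < d & forall x y, sumset K L x -> `|y - x| < d -> U y.
  apply: compact_uniform_nbhs => //; first exact: compact_sumset.
  move=> _ [x Kx [y Ly] <-]; apply: WU; have [] := XYT _ _ (KX _ Kx) (LY _ Ly); first by left.
  by right.
have mU : measurable U by exact: open_measurable.
pose G : set R := (U `|` shift_set (- D) U) `&` `[0, D[.
have fG : finmeas G by rewrite /G setIC; fmsr.
have GT : rmeas G <= rmeas T + 2 * e.
  have fV : finmeas (U `\` W `|` shift_set (- D) (U `\` W)) by fmsr.
  have := rmeasU_le fUW (finmeas_shift (- D) fUW); rewrite rmeas_shift; last by msr.
  have := rmeasU_le fT fV.
  suff : rmeas G <= rmeas (T `|` (U `\` W `|` shift_set (- D) (U `\` W))) by lra.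
  apply: rmeas_le; [by fmsr|by msr|].
  move=> t [/= Ut]; rewrite in_itv /= => tD.
  have [Tt|nTt] := pselect (T t); [by left|right].
  case: Ut => Ut; [left|right; rewrite /shift_set /=]; split => //.
    by case=> //; rewrite /shift_set /= => /TD /=; rewrite in_itv /=; lra.
  by case; rewrite /shift_set /= opprK ?addrK // => /TD /=; rewrite in_itv /=; lra.
have [N Nbig] : exists N : nat, D / Num.min (d / 2) e < N%:R.
  exists (Num.truncn (D / Num.min (d / 2) e)).+1; rewrite -truncn_le_nat //.
have [p Np pp] := prime_above N.
have p0 : 0 < p%:R :> R by rewrite ltr0n prime_gt0.
pose h : R := D / p%:R; have h0 : 0 < h by rewrite divr_gt0.
have hp : h *+ p = D by rewrite -mulr_natr mulfVK // gt_eqF.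
(* If [x] and [y] lie in the cells [i] and [j], then [x + y] is within [2 * h] of every point of the
   cell [i + j]. *)
have [hd he] : 2 * h < d /\ h < e.
  have m0 : 0 < Num.min (d / 2) e by rewrite lt_min e0 divr_gt0.
  have : h < Num.min (d / 2) e.
    rewrite /h ltr_pdivrMr // mulrC -ltr_pdivrMr //.
    by apply: lt_trans Nbig _; rewrite ltr_nat.
  by rewrite lt_min => /andP[hd ->]; split => //; lra.
(* The size of the ordinal type behind ['F_p]; it equals [p] only by a lemma. *)
pose P := (Zp_trunc (pdiv p)).+2.
have PE : P = p by exact: Fp_cast.
have hP : h *+ P = D by rewrite PE.
pose cell (i : nat) : set R := `[h *+ i, h *+ i.+1[%classic.
have cellE i t : cell i t = (h *+ i <= t < h *+ i + h) :> Prop by rewrite /cell /= in_itv /= mulrSr.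
pose hit Z : {set 'F_p} := [set i | `[< exists2 x, Z x & cell (val i) x >]]%SET.
have hit_ge Z : finmeas Z -> Z `<=` `[0, D[ -> rmeas Z <= h *+ #|hit Z|.
  move=> fZ ZD; rewrite -[Z in leLHS](setIidl ZD) -hP rmeas_cells //; last exact: ltW.
  rewrite -sumr_const big_mkcond [leRHS]big_mkcond /=; apply: ler_sum => i _.
  case: ifPn => [_|].
    apply: le_trans (rmeas_sub_itv _ _ (@subIsetr _ _ _)) _; [|by msr|].
      by rewrite mulrSr lerDl ltW.
    by rewrite mulrSr addrAC subrr add0r.
  rewrite inE => /asboolPn nZ; rewrite (_ : _ `&` _ = classical_sets.set0) ?rmeas0 //.
  by apply/seteqP; split => x //= [Zx cx]; apply: nZ; exists x.
have hit0 Z z : Z z -> Z `<=` `[0, D[ -> (0 < #|hit Z|)%N.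
  move=> Zz ZD; have /= := ZD _ Zz; rewrite in_itv /= => /andP[z0 zD].
  have zp : (Num.truncn (z / h) < P)%N.
    rewrite PE truncn_lt_nat; last by rewrite divr_ge0 // ltW.
    by rewrite ltr_pdivrMr // mulr_natl hp.
  apply/card_gt0P; exists (Ordinal zp); rewrite inE; apply/asboolP; exists z => //.
  rewrite cellE /=; have /andP[] := truncn_itv (divr_ge0 z0 (ltW h0)).
  by rewrite ler_pdivlMr // ltr_pdivrMr // !mulr_natl mulrSr => -> ->.
pose C : {set 'F_p} := [set i | `[< cell (val i) `<=` G >]]%SET.
have C_le : h *+ #|C| <= rmeas G.
  have : rmeas (G `&` `[0, h *+ P[) <= rmeas G by apply: rmeas_le => //; msr.
  apply: le_trans; rewrite rmeas_cells //; last exact: ltW.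
  rewrite -sumr_const big_mkcond [leRHS]big_mkcond /=; apply: ler_sum => i _.
  case: ifPn => [|_]; last exact: rmeas_ge0.
  rewrite inE => /asboolP iG; rewrite setIidr //.
  have hi : h *+ i <= h *+ i.+1 by rewrite mulrSr lerDl ltW.
  by rewrite rmeas_itv // mulrSr addrAC subrr add0r.
have hitC i j : i \in hit K -> j \in hit L -> i + j \in C.
  rewrite inE => /asboolP[x Kx ix]; rewrite inE => /asboolP[y Ly jy].
  move: ix jy; rewrite !cellE inE => ix jy; apply/asboolP => t; rewrite cellE /= => kt.
  have Uxy s : `|s - (x + y)| < d -> U s by apply: dU; exists x => //; exists y.
  have hij : h *+ (val i + val j) = h *+ val i + h *+ val j by rewrite mulrnDr.
  have ki : h *+ ((val i + val j) %% P)%N + h *+ 1 <= D.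
    by rewrite -mulrnDr -hP (ler_pMn2l h0) addn1 ltn_mod.
  have k0 : 0 <= h *+ ((val i + val j) %% P)%N by rewrite mulrn_wge0 // ltW.
  split; last by rewrite /= in_itv /=; lra.
  have [ijP|ijP] := ltnP (val i + val j) P.
    left; apply: Uxy; move: kt; rewrite modn_small // hij ltr_norml => kt; lra.
  right; rewrite /shift_set /= opprK; apply: Uxy.
  have kE : h *+ ((val i + val j) %% P)%N = h *+ (val i + val j) - D.
    rewrite -{1}(subnK ijP) modnDr modn_small ?mulrnBr ?hP //.
    rewrite ltn_subLR // -addSn; apply: leq_add; [exact: ltn_ord|exact/ltnW/ltn_ord].
  by move: kt; rewrite kE hij ltr_norml => kt; lra.
have K0 := hit0 _ _ Kx0 (subset_trans KX XD); have L0 := hit0 _ _ Ly0 (subset_trans LY YD).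
have CD := cauchy_davenport pp K0 L0 hitC.
have hK := hit_ge _ fK (subset_trans KX XD); have hL := hit_ge _ fL (subset_trans LY YD).
have hC : h *+ minn p (#|hit K| + #|hit L|).-1 <= h *+ #|C| by rewrite (ler_pMn2l h0).
have e1E : e1 = 5 * e by rewrite /e mulrC divfK.
have [pm|pm] := leqP p (#|hit K| + #|hit L|).-1.
  apply: (@le_trans _ _ D); first by rewrite ge_min lexx.
  by move: hC; rewrite (minn_idPl pm) hp; lra.
apply: (@le_trans _ _ (rmeas X + rmeas Y)); first by rewrite ge_min lexx orbT.
move: hC; rewrite (minn_idPr (ltnW pm)) -subn1 mulrnBr; last by rewrite ltn_addr.
by rewrite mulrnDr mulr1n; lra.
Qed.

End Raikov.

(** * Holes of critical sumsets *)

Section CriticalDef.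
Variable R : realType.
Implicit Types (X Y Z T : set R) (e f s t u v x y : R).

Definition holes D X : set R := `[0, D] `\` X.

(* [S] may be any measurable set containing the sumset of [A] and [B]. *)
Record critical (DA DB : R) (A B S : set R) : Prop := Critical {
  crit_mA : measurable A;
  crit_mB : measurable B;
  crit_mS : measurable S;
  crit_D : DB <= DA;
  crit_A : A `<=` `[0, DA];
  crit_B : B `<=` `[0, DB];
  crit_S : S `<=` `[0, DA + DB];
  crit_A0 : A 0;
  crit_AD : A DA;
  crit_B0 : B 0;
  crit_BD : B DB;
  crit_sum : forall a b, A a -> B b -> S (a + b);
  crit_small : rmeas S <= rmeas A + DB;
  crit_large : DB < 2 * rmeas B }.

End CriticalDef.

Ltac crlra := match goal with H : critical _ _ _ _ _ |- _ => have := crit_D H end; lra.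

Section Critical.
Variable R : realType.
Implicit Types (X Y Z T : set R) (e f s t u v x y : R).
Variables (DA DB : R) (A B S : set R).
Hypothesis cr : critical DA DB A B S.

Let C := holes DA A.
Let E := holes DB S.
(** A right hole is recorded by its offset: [F f] means that [DA + f] is missing from [S]. *)
Let F := holes DB (shift_set (- DA) S).
Let mA := crit_mA cr.
Let mB := crit_mB cr.
Let mS := crit_mS cr.

Lemma critical_finA : finmeas A.
Proof. by apply: finmeas_sub mA _ (crit_A cr); fmsr. Qed.

Lemma critical_finB : finmeas B.
Proof. by apply: finmeas_sub mB _ (crit_B cr); fmsr. Qed.

Lemma critical_finS : finmeas S.
Proof. by apply: finmeas_sub mS _ (crit_S cr); fmsr. Qed.

Lemma critical_finC : finmeas C.
Proof. by rewrite /C /holes; fmsr. Qed.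

Lemma critical_finE : finmeas E.
Proof. by rewrite /E /holes; fmsr. Qed.

Lemma critical_finF : finmeas F.
Proof. by rewrite /F /holes; fmsr. Qed.

Let fA := critical_finA.
Let fB := critical_finB.
Let fS := critical_finS.
Let fC := critical_finC.
Let fE := critical_finE.
Let fF := critical_finF.

Lemma critical_bound_B : 0 < DB /\ rmeas B <= DB.
Proof.
have DB0 : 0 <= DB by have /= := crit_B cr (crit_B0 cr); rewrite in_itv /= => /andP[].
have := rmeas_sub_itv DB0 mB (crit_B cr); have := crit_large cr; lra.
Qed.

Lemma critical_measC : rmeas C = DA - rmeas A.
Proof.
have [DB0 _] := critical_bound_B.
have fI : finmeas (`[0, DA]%classic : set R) by fmsr.
have := rmeasID fI mA; rewrite setIidr; last exact: crit_A cr.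
by rewrite rmeas_itv /C /holes => [|]; crlra.
Qed.

(* Modulo [DA] the sumset covers [B] twice, so Raikov's inequality forces it to be everything. *)
Lemma critical_circle : DA + rmeas B <= rmeas A + DB.
Proof.
have [DB0 _] := critical_bound_B; have DA0 : 0 < DA by crlra.
have sm := crit_small cr; have la := crit_large cr.
pose S0 : set R := S `&` `[0, DA[.
pose S1 : set R := shift_set (- DA) S `&` `[0, DA[.
have fS0 : finmeas S0 by rewrite /S0; fmsr.
have fS1 : finmeas S1 by rewrite /S1; fmsr.
have S01 : rmeas S0 + rmeas S1 <= rmeas S.
  rewrite -(rmeas_shift DA (X := S1)); last by msr.
  have f1 : finmeas (shift_set DA S1) by fmsr.
  rewrite -rmeasU_disj //.
    apply: rmeas_le; [by []|by msr|] => x [[]//|].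
    by rewrite /S1 /shift_set /= opprK subrK => -[].
  move=> x; rewrite /S0 /S1 /shift_set /= !in_itv /= => -[_ ?] [_ ?]; crlra.
(* [raikov] takes subsets of [[0, DA[], so the point [DA] is removed from [A], and from [B], which
   contains it if [DA = DB]. *)
have endpt X d : finmeas X -> rmeas (X `\` [set d]) = rmeas X.
  move=> fX; rewrite [RHS](@rmeasID _ X [set d]) //.
  have := @rmeas_le _ (X `&` [set d]) [set d] (finmeas_set1 _) _ (@subIsetr _ _ _).
  by rewrite rmeas_set1; have := rmeas_ge0 (X `&` [set d]); case: fX => mX _ ? /(_ _); move/(_ ltac:(msr)); crlra.
have BS : rmeas B <= rmeas (S0 `&` S1).
  rewrite -(endpt B DA) //; apply: rmeas_le; [by fmsr|by msr|].
  move=> x [Bx /= /eqP xD]; have /= := crit_B cr Bx; rewrite in_itv /= => x0.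
  have x1 : x < DA by rewrite lt_neqAle xD; crlra.
  split; split; rewrite /shift_set /= ?in_itv /= ?opprK.
  - by rewrite -[x]add0r; apply: crit_sum cr _ _ (crit_A0 cr) Bx.
  - crlra.
  - by rewrite addrC; apply: crit_sum cr _ _ (crit_AD cr) Bx.
  - crlra.
have := @raikov R DA (A `\` [set DA]) (B `\` [set DA]) (S0 `|` S1) DA0.
rewrite !endpt // => rk.
have : Num.min DA (rmeas A + rmeas B) <= rmeas (S0 `|` S1).
  apply: rk; [by msr|by msr|by msr| | |by move=> x [[]|[]]| | | ].
  - move=> x [/(crit_A cr) /=]; rewrite !in_itv /= => ? /eqP xD.
    by rewrite lt_neqAle xD; crlra.
  - move=> x [/(crit_B cr) /=]; rewrite !in_itv /= => ? /eqP xD.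
    by rewrite lt_neqAle xD; crlra.
  - by exists 0; split; [exact: crit_A0 cr|move=> /= ?; crlra].
  - by exists 0; split; [exact: crit_B0 cr|move=> /= ?; crlra].
  move=> x y [Ax /= /eqP xD] [By /= /eqP yD]; have Sxy := crit_sum cr Ax By.
  have /= := crit_A cr Ax; have /= := crit_B cr By; rewrite !in_itv /= => y0 x0.
  have xD' : x < DA by rewrite lt_neqAle xD; crlra.
  have yD' : y < DA by rewrite lt_neqAle yD; crlra.
  have [xy|xy] := ltP (x + y) DA.
    by left; left; split => //=; rewrite in_itv /=; crlra.
  right; right; split; rewrite /shift_set /= ?in_itv /= ?opprK ?subrK //; crlra.
(* If the minimum were m(A) + m(B), the double cover of [B] would give 2 m(B) <= [DB], against
   [crit_large]. *)
have := rmeasUI fS0 fS1.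
by rewrite ge_min => ? /orP[]; crlra.
Qed.

Lemma critical_measC_lt : rmeas C <= DB - rmeas B /\ rmeas C < rmeas B.
Proof. by rewrite critical_measC; have := critical_circle; have := crit_large cr; crlra. Qed.

(** For [x] in [B] the point [s - x] is not in [A], since [s] is not a sum; the bounds on [s] keep
    the reflected window inside [[0, DA]]. *)
Lemma hole_window s u v : ~ S s -> v <= s -> s <= DA + u ->
  rmeas (B `&` `[u, v]) <= rmeas (C `&` `[s - v, s - u]).
Proof.
move=> nS vs su; rewrite -(rmeas_flip s (X := B `&` _)); last by msr.
apply: rmeas_le; [by fmsr|by msr|].
move=> x; rewrite /flip_set /= => -[Bx]; rewrite !in_itv /= => sx.
split; last crlra.
split; first by rewrite /= in_itv /=; crlra.
by move=> Ax; apply: nS; have := crit_sum cr Ax Bx; rewrite addrC subrK.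
Qed.

Lemma left_hole e : E e -> rmeas (B `&` `[0, e]) <= rmeas (C `&` `[0, e]).
Proof.
move=> [/= + nS]; rewrite in_itv /= => e0.
by have := @hole_window e 0 e nS; rewrite subrr subr0; apply; crlra.
Qed.

Lemma right_hole_not_sum f : F f -> 0 <= f <= DB /\ ~ S (DA + f).
Proof. by move=> [/= + nS]; rewrite in_itv /= => f0; move: nS; rewrite /shift_set /= opprK addrC. Qed.

Lemma right_hole f : F f -> rmeas (B `&` `[f, DB]) <= rmeas (C `&` `[f + (DA - DB), DA]).
Proof.
move=> /right_hole_not_sum[f0 nS].
have := @hole_window (DA + f) f DB nS.
rewrite addrK (_ : DA + f - DB = f + (DA - DB)); last crlra.
by apply; crlra.
Qed.

(** The sum of the two reflections; [C] is counted twice only where the image windows overlap. *)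
Lemma holes_pair e f : E e -> F f ->
  rmeas (B `&` `[0, e]) + rmeas (B `&` `[f, DB])
    <= rmeas C + rmeas (C `&` `[f + (DA - DB), e]).
Proof.
move=> Ee Ff; have := left_hole Ee; have := right_hole Ff.
have [/= + _] := Ee; rewrite in_itv /= => e0; have [f0 _] := right_hole_not_sum Ff.
have f1 : finmeas (C `&` `[0, e]) by fmsr.
have f2 : finmeas (C `&` `[f + (DA - DB), DA]) by fmsr.
have := rmeasUI f1 f2.
have -> : C `&` `[0, e] `&` (C `&` `[f + (DA - DB), DA]) = C `&` `[f + (DA - DB), e].
  apply/seteqP; split => x /=; rewrite !in_itv /=.
    by case=> -[Cx ?] [_ ?]; split => //; crlra.
  by case=> Cx ?; split; split => //; crlra.
have : rmeas (C `&` `[0, e] `|` C `&` `[f + (DA - DB), DA]) <= rmeas C.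
  by apply: rmeas_le => //; [msr|move=> x [[]|[]]].
crlra.
Qed.

(** For [f <= e] the windows [[0, e]] and [[f, DB]] cover [B]. *)
Lemma holes_overlap e f : E e -> F f -> f <= e ->
  rmeas B - rmeas C <= rmeas (C `&` `[f + (DA - DB), e]).
Proof.
move=> Ee Ff fe; have := holes_pair Ee Ff.
suff : rmeas B <= rmeas (B `&` `[0, e]) + rmeas (B `&` `[f, DB]) by crlra.
apply: le_trans (rmeasU_le _ _); [|by fmsr..].
apply: rmeas_le; [by fmsr|by []|] => x Bx; have /= := crit_B cr Bx; rewrite in_itv /= => x0.
by have [xe|xe] := leP x e; [left|right]; split => //=; rewrite in_itv /=; crlra.
Qed.

(** A hole there would reflect the whole of [B] into the smaller set [C]. *)
Lemma critical_middle x : DB <= x <= DA -> S x.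
Proof.
move=> xD; apply: contrapT => nS; have [_ CB] := critical_measC_lt.
have [DB0 _] := critical_bound_B.
have := @hole_window x 0 DB nS; rewrite (setIidl (crit_B cr)).
have : rmeas (C `&` `[x - DB, x - 0]) <= rmeas C by apply: rmeas_le => //; msr.
by move=> h1 /(_ _ _); crlra.
Qed.

Lemma critical_EC e : E e -> C e.
Proof.
move=> [/= + nS]; rewrite in_itv /= => e0; split; first by rewrite /= in_itv /=; crlra.
by move=> Ae; apply: nS; rewrite -[e]addr0; exact: (crit_sum cr Ae (crit_B0 cr)).
Qed.

Lemma critical_FC f : F f -> C (f + (DA - DB)).
Proof.
move=> /right_hole_not_sum[f0 nS]; split; first by rewrite /= in_itv /=; crlra.
move=> Af; apply: nS; rewrite (_ : DA + f = f + (DA - DB) + DB); last crlra.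
exact: (crit_sum cr Af (crit_BD cr)).
Qed.

(** Otherwise the overlap window contains at most the point [e], yet it must carry measure m(B) -
    m(C) > 0. *)
Lemma holes_separated e f : E e -> F f -> f <= e -> f + (DA - DB) < e.
Proof.
move=> Ee Ff fe; rewrite ltNge; apply/negP => ef.
have := holes_overlap Ee Ff fe; have [_] := critical_measC_lt.
have : rmeas (C `&` `[f + (DA - DB), e]) <= rmeas [set e].
  apply: rmeas_le; [by fmsr|by msr|] => x [_ /=]; rewrite in_itv /= => ?.
  by apply/eqP; rewrite eq_le; crlra.
by rewrite rmeas_set1; crlra.
Qed.

Let FD := shift_set (DA - DB) F.

Lemma critical_EF_disj x : E x -> FD x -> False.
Proof.
move=> Ex; rewrite /FD /shift_set /= => Fx.
have := holes_separated Ex Fx; rewrite subrK ltxx => h; suff: false by []; apply: h.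
by crlra.
Qed.

Lemma critical_EF_sub : E `|` FD `<=` C.
Proof. by move=> x [/critical_EC//|/critical_FC]; rewrite subrK. Qed.

(** By [critical_middle] there is no hole between [DB] and [DA], so [E] and [F] shifted by [DA] are
    disjoint and exhaust the holes. *)
Lemma critical_measS : rmeas S + rmeas E + rmeas F = DA + DB.
Proof.
have [DB0 _] := critical_bound_B.
have fI : finmeas (`[0, DA + DB]%classic : set R) by fmsr.
have := rmeasID fI mS; rewrite setIidr; last exact: crit_S cr.
rewrite rmeas_itv ?subr0 ?addr_ge0 //; [|crlra|crlra] => ->.
rewrite -addrA; congr (_ + _); rewrite -(rmeas_shift DA (X := F)); last by msr.
rewrite -rmeasU_disj; [|by fmsr..|].
  congr rmeas; apply/seteqP; split => x.
    case=> [[/= + nS]|]; first by rewrite in_itv /= => ?; split => //=; rewrite in_itv /=; crlra.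
    rewrite /shift_set => /right_hole_not_sum[x0]; rewrite addrC subrK => nS.
    by split => //=; rewrite in_itv /=; crlra.
  move=> [/= + nS]; rewrite in_itv /= => x0.
  have [xDB|xDB] := leP x DB; first by left; split => //=; rewrite in_itv /=; crlra.
  right; rewrite /shift_set; split; first last.
    by rewrite /shift_set /= opprK subrK.
  rewrite /= in_itv /=; suff : DA < x by crlra.
  by rewrite ltNge; apply/negP => xDA; apply: nS; apply: critical_middle; crlra.
move=> x [/= + nS]; rewrite in_itv /= => x0 /right_hole_not_sum[x1 _].
by apply: nS; apply: critical_middle; crlra.
Qed.

(** [critical_measS] and [crit_small] give m(E) + m(F) >= m(C), while [E] and [FD] are disjoint
    parts of [C]; so both estimates are equalities. *)
Lemma critical_equality : rmeas S = rmeas A + DB /\ rmeas (C `\` (E `|` FD)) = 0.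
Proof.
have := critical_measS; have := crit_small cr; have := critical_measC.
have fEF : finmeas (E `|` FD) by rewrite /FD; fmsr.
have := @rmeasID _ C (E `|` FD) fC fEF.1; rewrite setIidr; last exact: critical_EF_sub.
rewrite rmeasU_disj //; [|by rewrite /FD; fmsr|exact: critical_EF_disj].
rewrite rmeas_shift; last by msr.
have := rmeas_ge0 (C `\` (E `|` FD)); crlra.
Qed.

Lemma critical_null Z : measurable Z -> Z `<=` C -> (forall x, Z x -> E x -> False) ->
  (forall x, Z x -> F (x - (DA - DB)) -> False) -> rmeas Z = 0.
Proof.
move=> mZ ZC ZE ZF; apply/eqP; rewrite eq_le rmeas_ge0 andbT.
rewrite -(proj2 critical_equality); apply: rmeas_le => //; first by rewrite /FD; fmsr.
by move=> x Zx; split; [exact: ZC|case; [exact: ZE|exact: ZF]].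
Qed.

(** If [f <= e], take a nearly last right hole [f1] up to [e] and a nearly first left hole [e1]
    after it. Between the supremum and the infimum that they approximate [C] is null, so the overlap
    window of [e1] and [f1] meets [C] in measure less than [2 * k], whereas [holes_overlap] asks for
    [3 * k]. *)
Lemma holes_order e f : E e -> F f -> e < f.
Proof.
move=> Ee Ff; rewrite ltNge; apply/negP => fe.
have [_ CB] := critical_measC_lt; pose k := (rmeas B - rmeas C) / 3.
have k0 : 0 < k by rewrite divr_gt0 //; crlra.
pose FE : set R := [set f' | F f' /\ f' <= e].
have sF : has_sup FE by split; [exists f|exists e => x []].
have [f1 [Ff1 f1e] f1k] := sup_adherent k0 sF.
have fle x : FE x -> x <= sup FE by move=> ?; exact: (ub_le_sup sF.2).
have sFe : sup FE + (DA - DB) <= e.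
  rewrite -lerBrDr; apply: (ge_sup sF.1) => x [Fx xe].
  by have := holes_separated Ee Fx xe; crlra.
pose EF : set R := [set e' | E e' /\ sup FE + (DA - DB) <= e'].
have iE : has_inf EF by split; [exists e|exists (sup FE + (DA - DB)) => x []].
have [e1 [Ee1 e1F] e1k] := inf_adherent k0 iE.
have ege x : EF x -> inf EF <= x by move=> ?; exact: (ge_inf iE.2).
have infe : inf EF <= e by apply: ege.
have infF : sup FE + (DA - DB) <= inf EF by apply: (lb_le_inf iE.1) => x [].
have f1s : f1 <= sup FE by apply: fle.
have f1e1 : f1 <= e1 by crlra.
have := holes_overlap Ee1 Ff1 f1e1.
have null : rmeas (C `&` `]sup FE + (DA - DB), inf EF[) = 0.
  apply: critical_null; [by msr|by move=> x []| | ].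
    by move=> x [_ /=]; rewrite in_itv /= => xi Ex; have := ege x; rewrite /EF /=;
      move=> /(_ (conj Ex _)); crlra.
  move=> x [_ /=]; rewrite in_itv /= => xi Fx.
  suff : x - (DA - DB) <= sup FE by crlra.
  by apply: fle; split => //; crlra.
pose I1 : set R := `[f1 + (DA - DB), sup FE + (DA - DB)]%classic.
pose I2 : set R := `[inf EF, e1]%classic.
have : rmeas (C `&` `[f1 + (DA - DB), e1])
    <= rmeas (I1 `|` ((C `&` `]sup FE + (DA - DB), inf EF[) `|` I2)).
  apply: rmeas_le; [by rewrite /I1 /I2; fmsr|by msr|].
  move=> x [Cx /=]; rewrite in_itv /= => xi.
  have [x1|x1] := leP x (sup FE + (DA - DB)); first by left; rewrite /I1 /= in_itv /=; crlra.
  have [x2|x2] := leP (inf EF) x; first by right; right; rewrite /I2 /= in_itv /=; crlra.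
  by right; left; split => //=; rewrite in_itv /=; crlra.
have fM : finmeas (C `&` `]sup FE + (DA - DB), inf EF[) by fmsr.
have fI1 : finmeas I1 by rewrite /I1; fmsr.
have fI2 : finmeas I2 by rewrite /I2; fmsr.
have := rmeasU_le fM fI2; have := rmeasU_le fI1 (finmeasU fM fI2).
rewrite null /I1 /I2 !rmeas_itv; [|exact: ege|by crlra].
by rewrite /k in f1k e1k *; crlra.
Qed.

End Critical.

(** * Sets of density at most one half near an end point *)

Section HalfDensity.
Variable R : realType.
Implicit Types (X Y Z T : set R) (e f s t u v x y : R).
Variables (DA DB : R) (A B S : set R).
Hypothesis cr : critical DA DB A B S.

Let C := holes DA A.
Let E := holes DB S.
Let F := holes DB (shift_set (- DA) S).
Let mA := crit_mA cr.
Let mB := crit_mB cr.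
Let mS := crit_mS cr.
Let fA : finmeas A := critical_finA cr.
Let fB : finmeas B := critical_finB cr.
Let fS : finmeas S := critical_finS cr.
Let fC : finmeas C := critical_finC cr.
Let fE : finmeas E := critical_finE cr.
Let fF : finmeas F := critical_finF cr.

Lemma critical_flip : critical DA DB (flip_set DA A) (flip_set DB B) (flip_set (DA + DB) S).
Proof.
split; [by msr|by msr|by msr|exact: crit_D cr| | | | | | | |..].
- by move=> x /(crit_A cr) /=; rewrite !in_itv /=; lra.
- by move=> x /(crit_B cr) /=; rewrite !in_itv /=; lra.
- by move=> x /(crit_S cr) /=; rewrite !in_itv /=; lra.
- by rewrite /flip_set /= subr0; exact: crit_AD cr.
- by rewrite /flip_set /= subrr; exact: crit_A0 cr.
- by rewrite /flip_set /= subr0; exact: crit_BD cr.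
- by rewrite /flip_set /= subrr; exact: crit_B0 cr.
- by move=> a b Aa Bb; have := crit_sum cr Aa Bb; rewrite /flip_set /= opprD addrACA.
- by rewrite !rmeas_flip //; exact: crit_small cr.
- by rewrite rmeas_flip //; exact: crit_large cr.
Qed.

Lemma critical_BS x : B x -> S x.
Proof. by move=> Bx; rewrite -[x]add0r; exact: (crit_sum cr (crit_A0 cr) Bx). Qed.

Variable c : R.
Hypotheses (c0 : 0 < c) (cD : c <= DA) (Ac : rmeas (A `&` `[0, c]) <= c / 2).

Ltac clra := move: c0 cD Ac (crit_D cr); lra.
Ltac cnra := move: c0 cD; nra.

Let half_densityC : c / 2 <= rmeas (C `&` `[0, c]).
Proof.
have fI : finmeas (`[0, c]%classic : set R) by fmsr.
have := rmeasID fI mA; rewrite rmeas_itv ?subr0; last exact: ltW.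
rewrite (setIC _ A) (_ : `[0, c] `\` A = C `&` `[0, c]); first by clra.
apply/seteqP; split => x /=; rewrite /C /holes /= !in_itv /=; last by case=> -[].
by case=> ? ?; split => //; split => //; clra.
Qed.

(** Suppose [f < w]. In [[0, w]] the sets [E], [F] and [B] are disjoint, so [B] has there at most
    [w] minus the measure of [C] in [[0, c]]. The rest of [B] is reflected into [C] above [c]. As
    [C] fills at least half of [[0, c]], the sum of both bounds is at most m(C) - ([DA - DB]), which
    is less than m(B). *)
Lemma half_density_right_hole f : F f -> c <= f + (DA - DB).
Proof.
move=> Ff; rewrite leNgt; apply/negP => fc; have [f0 _] := right_hole_not_sum Ff.
have [DB0 _] := critical_bound_B cr; have [CB _] := critical_measC_lt cr.
have la := crit_large cr.
(* [w] is the point [c] in the coordinate of [F]: [f + (DA - DB) < c] means [f < w]. *)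
pose z := DA - c; pose w := DB - z.
have fw : f < w by rewrite /w /z; clra.
have wD : w <= DB by rewrite /w /z; clra.
have EFB : rmeas E + rmeas (F `&` `[0, w]) + rmeas (B `&` `[0, w]) <= w.
  have fFw : finmeas (F `&` `[0, w]) by fmsr.
  have fBw : finmeas (B `&` `[0, w]) by fmsr.
  rewrite -rmeasU_disj //; last first.
    by move=> x Ex [Fx _]; have := holes_order cr Ex Fx; clra.
  rewrite -rmeasU_disj //; [|by fmsr|].
    rewrite -[leRHS]subr0; apply: (@rmeas_sub_itv _ true false); [by clra|by msr|].
    move=> x [[Ex|[_ //]]|[_ //]]; have xf := holes_order cr Ex Ff.
    by case: Ex => /=; rewrite !in_itv /= => x0 _; clra.
  move=> x [[_ nS]|[[_ nS] _]] [Bx _]; apply: nS; first exact: critical_BS.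
  by rewrite /shift_set /= opprK addrC; exact: (crit_sum cr (crit_AD cr) Bx).
have CEF : rmeas (C `&` `[0, c]) <= rmeas E + rmeas (F `&` `[0, w]).
  rewrite -(rmeas_shift (DA - DB) (X := F `&` _)); last by msr.
  have fU : finmeas (E `|` shift_set (DA - DB) (F `&` `[0, w])) by fmsr.
  apply: le_trans (rmeasU_le _ _); [|by fmsr..].
  apply: rmeas_null_le; [by fmsr|by []|].
  apply: (critical_null cr); [by msr|by move=> x [[]]| | ].
    by move=> x [_ nU] Ex; apply: nU; left.
  move=> x [[_ /=]]; rewrite in_itv /= => xc nU Fx; apply: nU; right.
  have [x0 _] := right_hole_not_sum Fx.
  by split => //=; rewrite in_itv /= /w /z; clra.
have BB : rmeas B <= rmeas (B `&` `[0, w]) + rmeas (B `&` `[w, DB]).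
  apply: le_trans (rmeasU_le _ _); [|by fmsr..].
  apply: rmeas_le; [by fmsr|by []|] => x Bx; have /= := crit_B cr Bx; rewrite in_itv /= => x0.
  by have [xw|xw] := leP x w; [left|right]; split => //=; rewrite in_itv /=; clra.
(* Reflection in [DA + f1] sends [[f1, f1 + z]] onto [[c, DA]]. The part of [B] above [f1 + z] goes
   below [c], where [C] is null beyond the shifted [sup Fw], so it costs at most [e]. *)
have B2 : rmeas (B `&` `[w, DB]) <= rmeas (C `&` `[c, DA]).
  apply/ler_addgt0Pr => e e0.
  pose Fw : set R := [set f | F f /\ f <= w].
  have sF : has_sup Fw by split; [exists f; split => //; clra|exists w => x []].
  have [f1 [Ff1 f1w] f1e] := sup_adherent e0 sF.
  have f1s : f1 <= sup Fw by apply: (ub_le_sup sF.2).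
  have [f10 nS1] := right_hole_not_sum Ff1.
  have sw : sup Fw <= w by apply: (ge_sup sF.1) => x [].
  have := @hole_window _ _ _ _ _ _ cr (DA + f1) f1 (f1 + z) nS1.
  have := @hole_window _ _ _ _ _ _ cr (DA + f1) (f1 + z) DB nS1.
  have -> : DA + f1 - (f1 + z) = c by rewrite /z; clra.
  have -> : DA + f1 - f1 = DA by clra.
  move=> h1 h2.
  have {}h1 := h1 ltac:(clra) ltac:(rewrite /z; clra).
  have {}h2 := h2 ltac:(rewrite /z; clra) ltac:(clra).
  have : rmeas (B `&` `[w, DB]) <= rmeas (B `&` `[f1, f1 + z]) + rmeas (B `&` `[f1 + z, DB]).
    apply: le_trans (rmeasU_le _ _); [|by fmsr..].
    apply: rmeas_le; [by fmsr|by msr|] => x [Bx /=]; rewrite in_itv /= => x0.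
    by have [xw|xw] := leP x (f1 + z); [left|right]; split => //=; rewrite in_itv /=; clra.
  have null : rmeas (C `&` `]sup Fw + (DA - DB), c]) = 0.
    apply: (critical_null cr); [by msr|by move=> x []| | ].
      move=> x [_ /=]; rewrite in_itv /= => xc Ex; have := holes_order cr Ex Ff1; clra.
    move=> x [_ /=]; rewrite in_itv /= => xc Fx.
    suff : x - (DA - DB) <= sup Fw by clra.
    by apply: (ub_le_sup sF.2); split => //; rewrite /w /z; clra.
  have : rmeas (C `&` `[DA + f1 - DB, c]) <= e.
    have -> : DA + f1 - DB = f1 + (DA - DB) by clra.
    have fI : finmeas (`[f1 + (DA - DB), sup Fw + (DA - DB)]%classic : set R) by fmsr.
    have fN : finmeas (C `&` `]sup Fw + (DA - DB), c]) by fmsr.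
    have := rmeasU_le fI fN; rewrite null rmeas_itv ?lerD2r // => hU.
    suff : rmeas (C `&` `[f1 + (DA - DB), c]) <= rmeas (`[f1 + (DA - DB), sup Fw + (DA - DB)]
        `|` C `&` `]sup Fw + (DA - DB), c]) by clra.
    apply: rmeas_le; [by fmsr|by msr|] => x [Cx /=]; rewrite in_itv /= => x0.
    have [xw|xw] := leP x (sup Fw + (DA - DB)); [left|right; split => //];
      by rewrite /= in_itv /=; clra.
  clra.
have CC : rmeas (C `&` `[0, c]) + rmeas (C `&` `[c, DA]) <= rmeas C.
  rewrite (@rmeasID _ C `[0, c]%classic fC) ?lerD2l; last by msr.
  apply: le_trans (_ : rmeas (C `\` `[0, c] `|` [set c]) <= _).
    apply: rmeas_le; [by fmsr|by msr|] => x [Cx /=]; rewrite in_itv /= => x0.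
    have [xc|xc] := leP x c; last by left; split => //=; rewrite in_itv /=; clra.
    by right; apply/eqP; rewrite eq_le; clra.
  have fCc : finmeas (C `\` `[0, c]) by fmsr.
  by have := rmeasU_le fCc (finmeas_set1 c); rewrite rmeas_set1 addr0.
have hC := half_densityC; have wE : w = c - (DA - DB) by rewrite /w /z; clra.
clra.
Qed.

(** Below [c] there are no shifted right holes, and a point of [S] is not in [E], so almost nothing
    of [C] remains. *)
Lemma half_density_stable Z : measurable Z -> Z `<=` S `&` `[0, c[ -> rmeas (Z `\` A) = 0.
Proof.
move=> mZ ZS; apply: (critical_null cr); [by msr| | |].
- by move=> x [/ZS[_ /=]]; rewrite /holes /= !in_itv /= => ? nA; split => //; clra.
- by move=> x [/ZS[Sx _] _] [].
move=> x [/ZS[_ /=]]; rewrite in_itv /= => xc _ /half_density_right_hole; clra.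
Qed.

Lemma half_density_stable_le u v : 0 <= u -> v <= c ->
  rmeas (S `&` `[u, v[) <= rmeas (A `&` `[u, v[).
Proof.
move=> u0 vc; pose I : set R := `[u, v[%classic.
have mI : measurable I by exact: measurable_itv.
have fSI : finmeas (S `&` I) by fmsr.
apply: rmeas_null_le; [by []|by fmsr|].
rewrite (_ : _ `\` _ = (S `&` I) `\` A).
  apply: half_density_stable; first by msr.
  by move=> x [Sx]; rewrite /I /= !in_itv /= => xI; split => //; clra.
by apply/seteqP; split => x /=; tauto.
Qed.

Section Growth.
Variable x : R.
Hypotheses (Bx : B x) (x0 : 0 < x) (xc : x <= c).
Ltac glra := move: c0 cD Ac x0 xc (crit_D cr); lra.
Ltac gnra := move: c0 cD x0 xc; nra.
Let chunk k : set R := `[x *+ k, x *+ k.+1[%classic.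
Let p := rmeas (B `&` `[0, x]).

Let chunk_AS k : x *+ k.+1 <= c -> rmeas (S `&` chunk k) <= rmeas (A `&` chunk k).
Proof. by move=> kc; apply: half_density_stable_le => //; apply: mulrn_wge0; exact: ltW. Qed.

Let measY : rmeas (B `&` `[0, x[) = p.
Proof.
apply/eqP; rewrite eq_le; apply/andP; split.
  apply: rmeas_le; [by fmsr|by msr|] => y [By /=]; rewrite in_itv /= => y0.
  by split => //=; rewrite in_itv /=; glra.
have fY : finmeas (B `&` `[0, x[) by fmsr.
have := rmeasU_le fY (finmeas_set1 x); rewrite rmeas_set1 addr0; apply: le_trans.
apply: rmeas_le; [by fmsr|by msr|] => y [By /=]; rewrite in_itv /= => y0.
have [yx|yx] := ltP y x; first by left; split => //=; rewrite in_itv /=; glra.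
by right; apply/eqP; rewrite eq_le; glra.
Qed.

(* A sum below [x *+ k.+1] lies in [S], hence almost surely in [A], and [x \in B] moves it to the
   next chunk: so the next chunk contains the sums modulo [x]. *)
Let chunk_step k : x *+ k.+1 <= c -> 0 < rmeas (A `&` chunk k) ->
  Num.min x (rmeas (A `&` chunk k) + p) <= rmeas (S `&` chunk k.+1).
Proof.
move=> kc Ak0; have xk : 0 <= x *+ k by rewrite mulrn_wge0 // ltW.
pose X : set R := shift_set (- (x *+ k)) (A `&` chunk k).
pose Y : set R := B `&` `[0, x[.
pose N : set R := shift_set (- (x *+ k)) ((S `&` chunk k) `\` A).
pose V : set R := shift_set (- (x *+ k.+1)) (S `&` chunk k.+1).
have mI j : measurable (chunk j) by exact: measurable_itv.
have mX : measurable X by rewrite /X; msr.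
have mY : measurable Y by rewrite /Y; msr.
have fV : finmeas V by rewrite /V; fmsr.
have fN : finmeas N by rewrite /N; fmsr.
have XI : X `<=` `[0, x[.
  by move=> t [_]; rewrite /chunk /= !in_itv /= opprK mulrSr; glra.
have := @raikov R x X Y (V `|` N) x0 mX mY.
rewrite measY rmeas_shift; last by msr.
move=> rk; apply: le_trans (rk _ _ _ _ _ _ _) _ => {rk} //.
- by msr.
- by move=> t [].
- move=> t [|] [].
    by move=> _; rewrite /chunk /= !in_itv /= opprK !mulrSr; glra.
  by move=> [_]; rewrite /chunk /= !in_itv /= opprK !mulrSr; glra.
- have [t At] := rmeas_gt0_ex Ak0; exists (t - x *+ k).
  by rewrite /X /shift_set /= opprK subrK.
- by exists 0; split; [exact: crit_B0 cr|rewrite /= in_itv /= lexx].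
- move=> t y Xt [By yI]; have := XI _ Xt; have : A (t + x *+ k).
    by case: Xt; rewrite opprK.
  move: yI; rewrite /= !in_itv /= => y0 At t0.
  have Sty : S (t + y + x *+ k) by rewrite addrAC; exact: (crit_sum cr At By).
  have [ty|ty] := ltP (t + y) x; last first.
    right; left; rewrite /V /shift_set /= opprK.
    have -> : t + y - x + x *+ k.+1 = t + y + x *+ k by rewrite mulrSr; glra.
    by split => //; rewrite /chunk /= in_itv /= !mulrSr; glra.
  left; have [Aty|nA] := pselect (A (t + y + x *+ k)).
    left; rewrite /V /shift_set /= opprK.
    have -> : t + y + x *+ k.+1 = t + y + x *+ k + x by rewrite mulrSr; glra.
    split; first exact: (crit_sum cr Aty Bx).
    by rewrite /chunk /= in_itv /= !mulrSr; glra.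
  right; rewrite /N /shift_set /= opprK; split => //; split => //.
  by rewrite /chunk /= in_itv /= !mulrSr; glra.
have := rmeasU_le fV fN; rewrite !rmeas_shift; [|by msr..].
suff -> : rmeas (S `&` chunk k `\` A) = 0 by rewrite addr0.
apply: half_density_stable; first by msr.
by move=> t [St]; rewrite /chunk /= in_itv /= => tk; split => //=; rewrite in_itv /=; glra.
Qed.

(** If p >= a = x^2 / c, then by [chunk_step] each chunk [k] inside [[0, c]] meets [A] in measure at
    least [a *+ k.+1], and [A] almost fills the last incomplete chunk. Together this is more than
    half of [[0, c]]. *)
Lemma half_density_endpoint : p < x ^+ 2 / c.
Proof.
rewrite ltNge; apply/negP; set a := x ^+ 2 / c => ap.
have ac : a * c = x ^+ 2 by rewrite /a divfK // gt_eqF.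
have a0 : 0 < a by rewrite divr_gt0 // exprn_gt0.
have ax k : x *+ k <= c -> a *+ k <= x.
  move=> kc; rewrite -(ler_pM2r c0) mulrnAl ac expr2 -mulrnAr ler_wpM2l //; exact: ltW.
have Aa k : x *+ k.+1 <= c -> a *+ k.+1 <= rmeas (A `&` chunk k).
  elim: k => [|k IH] kc; apply: le_trans (chunk_AS kc).
    rewrite mulr1n; apply: le_trans ap _; rewrite -measY; apply: rmeas_le; [by rewrite /chunk; fmsr|by msr|].
    by move=> y [By yI]; split; [exact: critical_BS|rewrite /chunk mulr0n mulr1n].
  have kc' : x *+ k.+1 <= c by apply: le_trans kc; rewrite [leRHS]mulrSr lerDl ltW.
  have Ak : 0 < rmeas (A `&` chunk k) by apply: lt_le_trans (IH kc'); rewrite pmulrn_lgt0.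
  apply: le_trans (chunk_step kc' Ak).
  by rewrite le_min ax //= [leLHS]mulrSr lerD // IH.
(* [q] counts the whole chunks in [[0, c]]; it is positive because [x <= c]. *)
have [q [q0 qc cq]] : exists q, [/\ (0 < q)%N, x *+ q <= c & c < x *+ q.+1].
  exists (Num.truncn (c / x)); have /andP[t1 t2] := truncn_itv (divr_ge0 (ltW c0) (ltW x0)).
  split.
  - by rewrite truncn_gt0 ler_pdivlMr // mul1r.
  - by rewrite -mulr_natl -ler_pdivlMr.
  - by rewrite -mulr_natl -ltr_pdivrMr.
have xq : 0 <= x *+ q by rewrite mulrn_wge0 // ltW.
have Aq : a * ((q * q.+1)%:R / 2) <= rmeas (A `&` `[0, x *+ q[).
  rewrite rmeas_cells //; last exact: ltW.
  apply: le_trans (_ : \sum_(i < q) a *+ i.+1 <= _); last first.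
    apply: ler_sum => i _; apply: Aa; apply: le_trans qc.
    by rewrite (ler_pMn2l x0).
  elim: (q) => [|n IHn]; first by rewrite big_ord0 mul0n mul0r mulr0.
  rewrite big_ord_recr /=; apply: le_trans (lerD IHn (lexx _)).
  suff -> : a * ((n.+1 * n.+2)%:R / 2) = a * ((n * n.+1)%:R / 2) + a *+ n.+1 by [].
  by rewrite -[a *+ _]mulr_natr !natrM -!natr1; field.
(* Chunk [q] leaves [[0, c]], but [chunk_step] controls [S] one chunk further than [A]. It is full
   because [c < x *+ q.+1] gives [x <= a *+ q.+1]. *)
have Sq : x <= rmeas (S `&` chunk q).
  case: q q0 qc cq xq Aq => // q _ qc cq _ _.
  have Ak : 0 < rmeas (A `&` chunk q) by apply: lt_le_trans (Aa _ qc); rewrite pmulrn_lgt0.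
  apply: le_trans (chunk_step qc Ak); rewrite le_min lexx /=.
  apply: le_trans (_ : a *+ q.+2 <= _); last by rewrite [leLHS]mulrSr lerD // Aa.
  rewrite -(ler_pM2r c0) mulrnAl ac expr2 -mulrnAr ler_wpM2l //; exact: ltW.
have Alast : c - x *+ q <= rmeas (A `&` `[x *+ q, c[).
  apply: le_trans (half_density_stable_le _ _) => //.
  have fI : finmeas (`[x *+ q, c[%classic : set R) by fmsr.
  have := rmeasID fI mS; rewrite rmeas_itv // (setIC _ S) => ->.
  rewrite gerDl.
  have fQ : finmeas (chunk q) by rewrite /chunk; fmsr.
  have := rmeasID fQ mS; rewrite (setIC _ S) /chunk rmeas_itv; last by rewrite mulrSr; glra.
  have : rmeas (`[x *+ q, c[ `\` S) <= rmeas (chunk q `\` S).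
    apply: rmeas_le; [by fmsr|by msr|] => y [/=]; rewrite in_itv /= => yI nS.
    by split => //; rewrite /chunk /= in_itv /=; glra.
  by move: Sq; rewrite /chunk mulrSr; glra.
have : rmeas (A `&` `[0, x *+ q[) + rmeas (A `&` `[x *+ q, c[) <= rmeas (A `&` `[0, c]).
  rewrite -rmeasU_disj; [|by fmsr..|].
    apply: rmeas_le; [by fmsr|by msr|] => y [|] [Ay /=]; rewrite in_itv /= => yI;
      by split => //=; rewrite in_itv /=; glra.
  by move=> y [_ /=]; rewrite in_itv /= => ? [_ /=]; rewrite in_itv /=; glra.
move=> tot; have {}tot : a * ((q * q.+1)%:R / 2) + (c - x *+ q) <= c / 2 by glra.
(* Multiplied by 2c, the inequality becomes (c - q x)^2 + q x^2 <= 0, which is false since q >=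
   1. *)
have : (a * ((q * q.+1)%:R / 2) + (c - x *+ q)) * (2 * c) <= c / 2 * (2 * c).
  by apply: ler_wpM2r => //; glra.
have q1 : 1 <= q%:R :> R by rewrite ler1n.
rewrite natrM -natr1 -[x *+ q]mulr_natr.
set Q : R := q%:R in q1 *.
have -> : (a * (Q * (Q + 1) / 2) + (c - x * Q)) * (2 * c) =
  (a * c) * (Q * (Q + 1)) + 2 * c * (c - x * Q) by field.
rewrite ac; gnra.
Qed.

End Growth.

(** [half_density_endpoint] needs a point of [B]. A point [y] of [B] close to the supremum of [B] in
    [[0, x]] loses less than the assumed excess [d]. *)
Lemma half_density_bound x : 0 < x <= c -> rmeas (B `&` `[0, x]) <= x ^+ 2 / c.
Proof.
move=> x0; rewrite leNgt; apply/negP => px; set p := rmeas _ in px.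
pose d := p - x ^+ 2 / c; have d0 : 0 < d by rewrite subr_gt0.
pose Bx : set R := B `&` `[0, x].
have sB : has_sup Bx.
  split; first by exists 0; split; [exact: crit_B0 cr|rewrite /= in_itv /=; clra].
  by exists x => y [_ /=]; rewrite in_itv /=; clra.
have [y [By yx] yd] := sup_adherent d0 sB.
have ys : y <= sup Bx by apply: (ub_le_sup sB.2).
have : p <= rmeas (B `&` `[0, y]) + (sup Bx - y).
  rewrite -(@rmeas_itv _ false false y (sup Bx)) //.
  apply: le_trans (rmeasU_le _ _); [|by fmsr..].
  apply: rmeas_le; [by fmsr|by msr|] => t Bt; have := ub_le_sup sB.2 Bt => ts.
  case: Bt => Bt /=; rewrite in_itv /= => t0.
  by have [ty|ty] := leP t y; [left; split => //|right]; rewrite /= in_itv /=; clra.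
move: yx; rewrite /= in_itv /= => yx hp.
have xc0 : 0 <= x ^+ 2 / c by rewrite divr_ge0 ?sqr_ge0 // ltW.
have y0 : 0 < y.
  rewrite lt_neqAle; apply/andP; split; last clra.
  apply/eqP => y0; have : rmeas (B `&` `[0, y]) <= y - 0.
    by apply: (@rmeas_sub_itv _ true false); [clra|msr|move=> t []].
  by move: hp yd; rewrite /d; clra.
have := half_density_endpoint By y0 _ => /(_ ltac:(clra)).
have : y ^+ 2 / c <= x ^+ 2 / c by rewrite ler_pM2r ?invr_gt0 //; cnra.
by move: hp yd; rewrite /d; clra.
Qed.

End HalfDensity.

(** * The case without right holes *)

Section Windows.
Variable R : realType.
Implicit Types (X : set R) (u v t s h l eps : R) (G : R -> R).

(** The window is a small ball around a density point of [X]. *)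
Lemma dense_interval X h eps : measurable X -> X `<=` `]0, h[ -> 0 < rmeas X -> 0 < eps ->
  exists u v, [/\ 0 <= u, u < v, v <= h & (1 - eps) * (v - u) <= rmeas (X `&` `[u, v])].
Proof.
move=> mX Xh X0 eps0.
have fX : finmeas X by apply: finmeas_sub mX _ Xh; fmsr.
have [N [mN N0 XN]] := lebesgue_density mX.
have [x [Xx nN]] : exists x, (X `\` N) x.
  apply: rmeas_gt0_ex; suff : rmeas (X `&` N) <= 0.
    by have := rmeasID fX mN; lra.
  have fN : finmeas N by split => //; rewrite N0.
  suff <- : rmeas N = 0 by apply: rmeas_le => //; msr.
  by rewrite /rmeas N0.
have {}XN := contrapT (fun nP => nN (XN x nP)).
rewrite /= indicE mem_set // in XN.
have near1 : \forall r \near (0 : R)^'+, ((1 - eps)%:E <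
    lebesgue_measure (X `&` ball x r) / lebesgue_measure (ball x r))%E.
  apply: (XN [set y | ((1 - eps)%:E < y)%E]).
  apply: open_nbhs_nbhs; split; first exact: open_ereal_gt_ereal.
  by rewrite /= lte_fin; lra.
have := Xh _ Xx; rewrite /= in_itv /= => xh.
pose d := Num.min x (h - x).
have d0 : 0 < d by rewrite lt_min; lra.
have nd : \forall r \near (0 : R)^'+, r < d by exact: nbhs_right_lt.
have n0 : \forall r \near (0 : R)^'+, 0 < r by exact: nbhs_right_gt.
have [r [[r1 rd] r0]] := filter_ex (filterI (filterI near1 nd) n0).
move: rd; rewrite lt_min => /andP[rx rh].
exists (x - r), (x + r); split; [by lra|by lra|by lra|].
have bI : ball x r = `]x - r, x + r[%classic :> set R by exact: ball_itv.
have fI : finmeas (`]x - r, x + r[%classic : set R) by fmsr.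
have fXI : finmeas (X `&` `]x - r, x + r[) by fmsr.
move: r1; rewrite bI !rmeasE // inver rmeas_itv; last by lra.
rewrite gt_eqF; last by lra.
rewrite -EFinM lte_fin ltr_pdivlMr; last by lra.
move=> /ltW /le_trans; apply; apply: rmeas_le; [by fmsr|by msr|].
by move=> y [Xy /=]; rewrite in_itv /= => yI; split => //=; rewrite in_itv /=; lra.
Qed.

(* Shifts by arbitrarily small steps compose to approximate any shift. *)
Lemma window_monotone G M : (forall u v, 0 <= u <= v -> 0 <= G v - G u <= v - u) ->
  (forall d, 0 < d -> exists s, 0 < s < d /\
     forall u v, 0 <= u <= v -> v + s <= M -> G v - G u <= G (v + s) - G (u + s)) ->
  forall u v l, 0 <= u <= v -> 0 <= l -> v + l <= M -> G v - G u <= G (v + l) - G (u + l).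
Proof.
move=> GL steps u v l uv l0 vl; apply/ler_addgt0Pr => e e0.
have [s [s0 Gs]] := steps _ e0.
have iter k : v + s *+ k <= M -> G v - G u <= G (v + s *+ k) - G (u + s *+ k).
  elim: k => [|k IHk] kM; first by rewrite mulr0n !addr0.
  have k0 : 0 <= s *+ k by rewrite mulrn_wge0 //; lra.
  move: kM; rewrite mulrSr !addrA => kM; apply: le_trans (IHk _) _; first by lra.
  by apply: Gs => //; lra.
have /andP[n1 n2] := truncn_itv (divr_ge0 l0 (ltW (proj1 (andP s0)))).
set n := Num.truncn _ in n1 n2.
have sn : s *+ n <= l by rewrite -mulr_natl -ler_pdivlMr //; lra.
have ns : l < s *+ n + s by rewrite -mulrSr -mulr_natl -ltr_pdivrMr //; lra.
have sn0 : 0 <= s *+ n by rewrite mulrn_wge0 //; lra.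
have := iter n; have := GL (v + s *+ n) (v + l); have := GL (u + s *+ n) (u + l).
move=> /(_ ltac:(lra)) h1 /(_ ltac:(lra)) h2 /(_ ltac:(lra)) h3; lra.
Qed.

Definition cumul X t : R := rmeas (X `&` `[0, t]).

Lemma cumulB X u v : finmeas X -> 0 <= u <= v -> cumul X v - cumul X u = rmeas (X `&` `[u, v]).
Proof.
move=> fX uv; have fv : finmeas (X `&` `[0, v]) by fmsr.
have fu : finmeas (X `&` `[0, u]) by fmsr.
have fw : finmeas (X `&` `[u, v]) by fmsr.
have := rmeasUI fu fw.
have -> : X `&` `[0, u] `|` X `&` `[u, v] = X `&` `[0, v].
  apply/seteqP; split => x /=; rewrite !in_itv /=.
    by move=> [|] [Xx ?]; split => //; lra.
  by move=> [Xx ?]; have [xu|xu] := leP x u; [left|right]; split => //; lra.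
have : rmeas (X `&` `[0, u] `&` (X `&` `[u, v])) <= rmeas [set u].
  apply: rmeas_le; [by fmsr|by msr|] => x [[_ /=]]; rewrite in_itv /= => ? [_ /=].
  by rewrite in_itv /= => ?; apply/eqP; rewrite eq_le; lra.
rewrite rmeas_set1; have := rmeas_ge0 (X `&` `[0, u] `&` (X `&` `[u, v])).
by rewrite /cumul; lra.
Qed.

Lemma cumul_lip X u v : finmeas X -> 0 <= u <= v -> 0 <= cumul X v - cumul X u <= v - u.
Proof.
move=> fX uv; rewrite cumulB // rmeas_ge0 /=.
by apply: (@rmeas_sub_itv _ true false); [lra|msr|move=> x []].
Qed.

Lemma cumul0 X : finmeas X -> cumul X 0 = 0.
Proof.
move=> fX; apply/eqP; rewrite eq_le rmeas_ge0 andbT -{2}(subrr 0).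
by apply: (@rmeas_sub_itv _ true false); [lra|msr|move=> x []].
Qed.

(* By Lebesgue density some window is almost full, and all later windows are at least as full. *)
Lemma monotone_cumul_full X M : measurable X -> 0 < M -> X `<=` `[0, M] ->
  (forall u v l, 0 <= u <= v -> 0 <= l -> v + l <= M ->
     cumul X v - cumul X u <= cumul X (v + l) - cumul X (u + l)) ->
  (forall h, 0 < h -> 0 < cumul X h) -> M <= rmeas X.
Proof.
move=> mX M0 XM mono pos.
have fX : finmeas X by apply: finmeas_sub mX _ XM; fmsr.
have -> : rmeas X = cumul X M by rewrite /cumul setIidl.
apply/ler_addgt0Pr => e e0.
have [h [h0 hM he]] : exists h, [/\ 0 < h, h < M & 3 * h < e].
  exists (Num.min (M / 2) (e / 4)); split.
  - by rewrite lt_min; lra.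
  - by rewrite gt_min; lra.
  - have : Num.min (M / 2) (e / 4) <= e / 4 by rewrite ge_min lexx orbT.
    lra.
pose eps := h / M; have eps0 : 0 < eps by rewrite divr_gt0.
pose Y : set R := X `&` `]0, h[.
have mY : measurable Y by rewrite /Y; msr.
have Y0 : 0 < rmeas Y.
  have fY : finmeas Y by rewrite /Y; fmsr.
  apply: lt_le_trans (pos _ h0) _.
  have := rmeasU_le fY (finmeasU (finmeas_set1 0) (finmeas_set1 h)).
  have := rmeasU_le (finmeas_set1 (0 : R)) (finmeas_set1 h); rewrite !rmeas_set1.
  suff : cumul X h <= rmeas (Y `|` ([set 0] `|` [set h])) by lra.
  apply: rmeas_le; [by fmsr|by msr|] => x [Xx /=]; rewrite in_itv /= => xh.
  have [->|x0] := eqVneq x 0; first by right; left.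
  have [->|xh'] := eqVneq x h; first by right; right.
  by left; split => //=; rewrite in_itv /= !lt_neqAle eq_sym x0 xh'; lra.
have [u [v [u0 uv vh dens]]] := dense_interval mY (@subIsetr _ _ _) Y0 eps0.
have {}dens : (1 - eps) * (v - u) <= cumul X v - cumul X u.
  rewrite cumulB //; last lra.
  apply: le_trans dens _; apply: rmeas_le; [by fmsr|by msr|].
  by move=> x [[]].
pose l := v - u; have l0 : 0 < l by rewrite /l; lra.
have iter n : h + l *+ n <= M -> (1 - eps) * (l *+ n) <= cumul X (h + l *+ n).
  elim: n => [|n IHn] nM; first by rewrite mulr0n mulr0 rmeas_ge0.
  have ln : 0 <= l *+ n by rewrite mulrn_wge0 // ltW.
  move: nM; rewrite mulrSr mulrDr addrA => nM.
  have := IHn ltac:(lra).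
  have := mono u v (h + l *+ n - u) ltac:(lra) ltac:(lra) ltac:(rewrite /l in nM *; lra).
  have -> : u + (h + l *+ n - u) = h + l *+ n by lra.
  have -> : v + (h + l *+ n - u) = h + l *+ n + l by rewrite /l; lra.
  move: dens; rewrite -/l; lra.
have Mh : 0 <= M - h by lra.
have /andP[n1 n2] := truncn_itv (divr_ge0 Mh (ltW l0)).
set n := Num.truncn _ in n1 n2.
have sn : l *+ n <= M - h by rewrite -mulr_natl -ler_pdivlMr.
have ns : M - h < l *+ n + l by rewrite -mulrSr -mulr_natl -ltr_pdivrMr.
have ln : 0 <= l *+ n by rewrite mulrn_wge0 // ltW.
have := iter n ltac:(lra).
have := @cumul_lip X (h + l *+ n) M fX ltac:(lra).
have epsM : eps * (l *+ n) <= h.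
  apply: le_trans (_ : eps * M <= _); last by rewrite /eps divfK // gt_eqF.
  by rewrite ler_wpM2l ?ltW //; lra.
have lh : l <= h by rewrite /l; lra.
by rewrite mulrBl mul1r; lra.
Qed.

End Windows.

Section NoRightHole.
Variable R : realType.
Variables (DA DB : R) (A B S : set R).
Hypothesis cr : critical DA DB A B S.

Let C := holes DA A.
Let E := holes DB S.
Let F := holes DB (shift_set (- DA) S).
Let mA := crit_mA cr.
Let mB := crit_mB cr.
Let mS := crit_mS cr.
Let fB : finmeas B := critical_finB cr.
Let fC : finmeas C := critical_finC cr.
(** By [critical_measC] this is [DA] - (m(A) + m(B) - [DB]), the greatest b + c for which I has the
    required length. *)
Let M := rmeas C + (DB - rmeas B).

(** The hypothesis puts holes arbitrarily close to [M]. Reflection in [M] then preserves measure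
    ([KG]), and composed with reflection in a hole [e] it moves windows of [B] by the small step
    [M - e] without loss. By [monotone_cumul_full], [B] fills [[0, M]]; but its measure there is at
    most m(C) < [M]. *)
Lemma critical_no_right_hole : rmeas B < DB ->
  (forall b, 0 <= b < M -> 0 < rmeas (E `&` `[b, M])) -> False.
Proof.
move=> BD pos.
have fE : finmeas E := critical_finE cr.
have [DB0 _] := critical_bound_B cr; have [CB CB'] := critical_measC_lt cr.
have ME : M = rmeas C + (DB - rmeas B) by [].
have M0 : 0 < M by have := rmeas_ge0 C; lra.
have MD : M < DB by move: CB'; rewrite -/C; lra.
have near_hole d : 0 < d -> exists e, [/\ E e, M - d < e & 0 <= e < M].
  move=> d0; pose b := Num.max 0 (M - d / 2).
  have b0 : 0 <= b < M by rewrite le_max lexx /= gt_max; lra.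
  have : 0 < rmeas ((E `&` `[b, M]) `\` [set M]).
    have fb : finmeas (E `&` `[b, M]) by fmsr.
    have := rmeasID fb (measurable_set1 M); have := pos _ b0.
    suff : rmeas (E `&` `[b, M] `&` [set M]) <= rmeas [set M] by rewrite rmeas_set1; lra.
    by apply: rmeas_le; [fmsr|msr|move=> x []].
  move=> /rmeas_gt0_ex[x [[Ex /=]]]; rewrite in_itv /= => bx /eqP xM.
  have xM' : x < M by rewrite lt_neqAle xM; lra.
  have : M - d / 2 <= b by rewrite le_max lexx orbT.
  by move=> h; exists x; split => //; lra.
pose G := cumul B; pose K := cumul C.
have GL u v : 0 <= u <= v -> 0 <= G v - G u <= v - u by exact: cumul_lip.
have KL u v : 0 <= u <= v -> 0 <= K v - K u <= v - u by exact: cumul_lip.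
have GK e u v : E e -> 0 <= u <= v -> v <= e -> G v - G u <= K (e - u) - K (e - v).
  move=> Ee uv ve; rewrite !cumulB //; [|lra..].
  have [/= + nS] := Ee; rewrite in_itv /= => e0.
  apply: (hole_window cr) => //; first crlra.
(* [GK] in the limit where [e] tends to [M]; the Lipschitz bounds pay for the part of the window
   beyond [e]. *)
have GKM u v : 0 <= u <= v -> v <= M -> G v - G u <= K (M - u) - K (M - v).
  move=> uv vM; apply/ler_addgt0Pr => d d0.
  have [e [Ee eM e0]] := near_hole (d / 2) ltac:(lra).
  have [ve|ve] := leP v e.
    have := GK _ _ _ Ee uv ve; have := KL (e - u) (M - u) ltac:(lra).
    have := KL (e - v) (M - v) ltac:(lra); lra.
  have [ue|ue] := leP u e.
    have := GK _ u e Ee ltac:(lra) ltac:(lra); rewrite subrr.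
    have := KL (e - u) (M - u) ltac:(lra); have := KL 0 (M - v) ltac:(lra).
    have := GL e v ltac:(lra); lra.
  have := GL u v uv; have := KL (M - v) (M - u) ltac:(lra); lra.
have G0 : G 0 = 0 by exact: cumul0.
have K0 : K 0 = 0 by exact: cumul0.
have KC : K M <= rmeas C by apply: rmeas_le => //; msr.
have GC : rmeas C <= G M.
  have : rmeas B <= rmeas (B `&` `[0, M]) + rmeas (`[M, DB]%classic : set R).
    apply: le_trans (rmeasU_le _ _); [|by fmsr..].
    apply: rmeas_le; [by fmsr|by []|] => x Bx; have /= := crit_B cr Bx; rewrite in_itv /= => x0.
    by have [xM|xM] := leP x M; [left; split => //|right]; rewrite /= in_itv /=; lra.
  by rewrite rmeas_itv -/(cumul B M) -/(G M); lra.
(* From [GC], [KC] and [GKM] on [[0, M]] follow [G M = K M] = m(C), so [GKM] cannot be strict on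
   either of the two complementary windows. *)
have KG y : 0 <= y <= M -> K y = G M - G (M - y).
  move=> y0; have := GKM 0 (M - y) ltac:(lra) ltac:(lra).
  have := GKM (M - y) M ltac:(lra) ltac:(lra).
  rewrite subrr subr0 (_ : M - (M - y) = y) ?K0 ?G0; lra.
have full : M <= rmeas (B `&` `[0, M]).
  have BM t : t <= M -> cumul (B `&` `[0, M]) t = G t.
    move=> tM; rewrite /cumul /G /cumul; congr rmeas; apply/seteqP; split => x /=; rewrite !in_itv /=.
      by move=> [[]].
    by move=> [Bx x0]; split => //; split => //; lra.
  apply: monotone_cumul_full => //; [by msr| |].
    move=> u v l uv l0 vl; rewrite !BM; [|lra..].
    apply: (window_monotone GL) vl => // d d0.
    have [e [Ee eM e0]] := near_hole d d0.
    exists (M - e); split; first lra.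
    move=> u' v' uv' vM; have := GK _ _ _ Ee uv' ltac:(lra).
    rewrite !KG; [|lra..].
    have -> : M - (e - u') = u' + (M - e) by lra.
    have -> : M - (e - v') = v' + (M - e) by lra.
    lra.
  move=> h h0; have [hM|hM] := ltP h M; last first.
    apply: lt_le_trans (_ : rmeas C <= _).
      apply: lt_le_trans (pos 0 _) _; first lra.
      by apply: rmeas_le => //; [msr|move=> x [Ex _]; exact: (critical_EC cr Ex)].
    apply: le_trans GC _; apply: rmeas_le; [by fmsr|by msr|].
    by move=> x [Bx xM]; split => //; move: xM; rewrite /= !in_itv /=; lra.
  rewrite BM; last by exact: ltW.
  have := KG (M - h) ltac:(lra); have := KG M ltac:(lra).
  rewrite subrr G0 (_ : M - (M - h) = h); last by lra.
  have := @cumulB _ C (M - h) M fC ltac:(lra).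
  have : rmeas (E `&` `[M - h, M]) <= rmeas (C `&` `[M - h, M]).
    by apply: rmeas_le; [fmsr|msr|move=> x [Ex xI]; split => //; exact: (critical_EC cr Ex)].
  have := pos (M - h) ltac:(lra); rewrite -/K; lra.
have := KG M ltac:(lra); rewrite subrr G0.
by move: full; rewrite -/(cumul B M) -/(G M); lra.
Qed.

End NoRightHole.

(** * The cut points *)

Section Cuts.
Variable R : realType.
Implicit Types (Z : set R) (b c e f x : R).
Variables (DA DB : R) (A B S : set R).
Hypothesis cr : critical DA DB A B S.

Let C := holes DA A.
Let E := holes DB S.
Let F := holes DB (shift_set (- DA) S).
Let mA := crit_mA cr.
Let mB := crit_mB cr.
Let mS := crit_mS cr.
Let fA : finmeas A := critical_finA cr.
Let fB : finmeas B := critical_finB cr.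
Let fS : finmeas S := critical_finS cr.
Let fC : finmeas C := critical_finC cr.
Let fE : finmeas E := critical_finE cr.
Let fF : finmeas F := critical_finF cr.
Let M := rmeas C + (DB - rmeas B).
(** The added points stand for an absent hole, so that the bounds below also cover empty [E] or
    [F]. *)
Let E0 : set R := E `|` [set 0].
Let F1 : set R := F `|` [set DB].

Let ME : M = rmeas C + (DB - rmeas B). Proof. by []. Qed.

(** Both end windows of [B] are reflected into parts of [C] that share at most a point, and the rest
    of [B] lies in [[e, f]]; hence m(B) <= m(C) + ([f - e]). *)
Lemma critical_radii e f : E0 e -> F1 f -> 0 <= e /\ f <= DB /\ e + (DB - f) <= M.
Proof.
move=> Ee Ff; have [DB0 _] := critical_bound_B cr.
have e0 : 0 <= e <= DB by case: Ee => [[/= + _]|->]; rewrite ?in_itv /=; lra.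
have f0 : 0 <= f <= DB by case: Ff => [[/= + _]|->]; rewrite ?in_itv /=; lra.
have ef : e <= f.
  case: Ee => [Ee|->]; last by lra.
  by case: Ff => [Ff|->]; [exact: ltW (holes_order cr Ee Ff)|lra].
split; [by lra|split; [by lra|]].
have point Y x y : finmeas Y -> y <= x -> rmeas (Y `&` `[x, y]) <= 0.
  move=> fY yx; rewrite -(rmeas_set1 x); apply: rmeas_le; [by fmsr|by msr|].
  by move=> z [_ /=]; rewrite in_itv /= => ?; apply/eqP; rewrite eq_le; lra.
have Be : rmeas (B `&` `[0, e]) <= rmeas (C `&` `[0, e]).
  case: Ee => [Ee|->]; first exact: (left_hole cr Ee).
  by apply: le_trans (point _ _ _ fB _) _; rewrite ?rmeas_ge0.
have Bf : rmeas (B `&` `[f, DB]) <= rmeas (C `&` `[f + (DA - DB), DA]).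
  case: Ff => [Ff|->]; first exact: (right_hole cr Ff).
  by apply: le_trans (point _ _ _ fB _) _; rewrite ?rmeas_ge0.
have f1 : finmeas (C `&` `[0, e]) by fmsr.
have f2 : finmeas (C `&` `[f + (DA - DB), DA]) by fmsr.
have : rmeas (C `&` `[0, e] `&` (C `&` `[f + (DA - DB), DA])) <= 0.
  rewrite -(rmeas_set1 e); apply: rmeas_le; [by fmsr|by msr|].
  move=> z [[_ /=] + [_ /=]]; rewrite !in_itv /= => ? ?.
  by apply/eqP; rewrite eq_le; crlra.
have : rmeas (C `&` `[0, e] `|` C `&` `[f + (DA - DB), DA]) <= rmeas C.
  by apply: rmeas_le => //; [msr|move=> x [[]|[]]].
have := rmeasUI f1 f2.
have fef : finmeas (`[e, f]%classic : set R) by fmsr.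
have fBe : finmeas (B `&` `[0, e]) by fmsr.
have fBf : finmeas (B `&` `[f, DB]) by fmsr.
have := rmeasU_le (finmeasU fBe fef) fBf; have := rmeasU_le fBe fef.
have : rmeas B <= rmeas (B `&` `[0, e] `|` `[e, f] `|` B `&` `[f, DB]).
  apply: rmeas_le; [by fmsr|by []|] => x Bx; have /= := crit_B cr Bx; rewrite in_itv /= => x0.
  have [xe|xe] := leP x e; first by left; left; split => //=; rewrite in_itv /=; lra.
  have [xf|xf] := leP x f; first by left; right; rewrite /= in_itv /=; lra.
  by right; split => //=; rewrite in_itv /=; lra.
by rewrite rmeas_itv // ME; lra.
Qed.

(** Null rather than empty: [b] may have to lie below the supremum of [E] to leave room for a
    positive [c]. *)
Definition cuts b c := [/\ 0 <= b, 0 <= c, b + c <= M, rmeas (E `&` `]b, DB]) = 0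
  & rmeas (F `&` `[0, DB - c[) = 0].

(** Here every positive [c] is admissible on the right, so it suffices to find [b < M] beyond which
    [E] is null; [critical_no_right_hole] excludes that there is none. *)
Lemma critical_cuts_left : (forall f, F f -> DB <= f) -> rmeas B < DB ->
  exists b c, [/\ 0 < b, 0 < c & cuts b c].
Proof.
move=> noF BD; have M0 : 0 < M by rewrite ME; have := rmeas_ge0 C; lra.
have F1D : F1 DB by right.
have E0M e : E0 e -> e <= M by move=> Ee; have := critical_radii Ee F1D; lra.
have Fnull c : 0 < c -> rmeas (F `&` `[0, DB - c[) = 0.
  move=> c0; rewrite (_ : _ `&` _ = set0) ?rmeas0 //.
  by apply/seteqP; split => x //= [/noF]; rewrite in_itv /=; lra.
suff [b [b0 bM Eb]] : exists b, [/\ 0 < b, b < M & rmeas (E `&` `]b, DB]) = 0].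
  by exists b, (M - b); split; [|lra|split; [lra|lra|lra| |apply: Fnull; lra]].
have [[b [b0 Eb]]|noB] := pselect (exists b, 0 <= b < M /\ ~ 0 < rmeas (E `&` `[b, M])).
  exists (Num.max b (M / 2)); split.
  - by rewrite lt_max; lra.
  - by rewrite gt_max; lra.
  have Eb0 : rmeas (E `&` `[b, M]) = 0.
    by apply/eqP; rewrite eq_le rmeas_ge0 andbT leNgt; exact/negP.
  apply: rmeas_null_sub Eb0 _; [by fmsr|by msr|].
  move=> x [Ex /=]; rewrite !in_itv /= gt_max => /andP[/andP[bx _] _]; split => //.
  by rewrite (ltW bx) /=; apply: E0M; left.
case: (critical_no_right_hole cr BD) => b b0.
by apply: contrapT => nb; apply: noB; exists b.
Qed.

End Cuts.

Section Structure.
Variable R : realType.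
Implicit Types (Z : set R) (b c e f x : R).
Variables (DA DB : R) (A B S : set R).
Hypothesis cr : critical DA DB A B S.

Let C := holes DA A.
Let E := holes DB S.
Let F := holes DB (shift_set (- DA) S).
Let mA := crit_mA cr.
Let mB := crit_mB cr.
Let mS := crit_mS cr.
Let fE : finmeas E := critical_finE cr.
Let fF : finmeas F := critical_finF cr.

Lemma flip_holes_left x : holes DB (flip_set (DA + DB) S) x <-> F (DB - x).
Proof.
rewrite /F /holes /flip_set /shift_set /= !in_itv /= opprK.
by rewrite (_ : DA + DB - x = DB - x + DA); [split=> -[? ?]; split => //; lra|lra].
Qed.

Lemma flip_holes_right x :
  holes DB (shift_set (- DA) (flip_set (DA + DB) S)) x <-> E (DB - x).
Proof.
rewrite /E /holes /flip_set /shift_set /= !in_itv /= opprK.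
by rewrite (_ : DA + DB - (x + DA) = DB - x); [split=> -[? ?]; split => //; lra|lra].
Qed.

Lemma cuts_flip b c : cuts DA DB (flip_set DA A) (flip_set DB B) (flip_set (DA + DB) S) b c ->
  cuts DA DB A B S c b.
Proof.
case=> b0 c0 bc Eb Fc; split => //.
- move: bc; rewrite /= (critical_measC cr) (critical_measC (critical_flip cr)) !rmeas_flip //.
  lra.
- rewrite -(rmeas_flip DB); last by msr.
  rewrite -[RHS]Fc; congr rmeas; apply/seteqP; split => x; rewrite /flip_set /=.
    by move=> [Ex]; rewrite !in_itv /= => xI; split; [exact/flip_holes_right|have := Ex.1; rewrite /= in_itv /=; lra].
  by move=> [/flip_holes_right Ex]; rewrite !in_itv /= => xI; split => //; lra.
- rewrite -(rmeas_flip DB); last by msr.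
  rewrite -[RHS]Eb; congr rmeas; apply/seteqP; split => x; rewrite /flip_set /=.
    by move=> [Ex]; rewrite !in_itv /= => xI; split; [exact/flip_holes_left|have := Ex.1; rewrite /= in_itv /=; lra].
  by move=> [/flip_holes_left Ex]; rewrite !in_itv /= => xI; split => //; lra.
Qed.

(** The suprema of [E] and of the reflected [F] serve as [b] and [c]. If m(B) < [DB] and one of them
    vanishes, [critical_cuts_left] replaces both, after a reflection if it is the left one. *)
Lemma critical_cuts : exists b c, cuts DA DB A B S b c /\ (rmeas B < DB -> 0 < b /\ 0 < c).
Proof.
have [DB0 _] := critical_bound_B cr.
pose E0 : set R := E `|` [set 0]; pose G : set R := [set x | F (DB - x)] `|` [set 0].
have rad e x : E0 e -> G x -> 0 <= e /\ 0 <= x /\ e + x <= rmeas C + (DB - rmeas B).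
  move=> Ee Gx; have F1 : (F `|` [set DB]) (DB - x) by case: Gx => [|->]; [left|right; rewrite subr0].
  by have := critical_radii cr Ee F1; rewrite -/C; lra.
have E00 : E0 0 by right.
have G0 : G 0 by right.
have sE : has_sup E0.
  split; first by exists 0.
  by exists (rmeas C + (DB - rmeas B)) => e Ee; have := rad _ _ Ee G0; lra.
have sG : has_sup G.
  split; first by exists 0.
  by exists (rmeas C + (DB - rmeas B)) => x Gx; have := rad _ _ E00 Gx; lra.
have bc : sup E0 + sup G <= rmeas C + (DB - rmeas B).
  rewrite -lerBrDr; apply: (ge_sup sE.1) => e Ee; rewrite lerBrDr addrC -lerBrDr.
  by apply: (ge_sup sG.1) => x Gx; have := rad _ _ Ee Gx; lra.
have b0 : 0 <= sup E0 by exact: (ub_le_sup sE.2 E00).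
have c0 : 0 <= sup G by exact: (ub_le_sup sG.2 G0).
have cut : cuts DA DB A B S (sup E0) (sup G).
  split => //.
    rewrite (_ : _ `&` _ = set0) ?rmeas0 //; apply/seteqP; split => x //= [Ex].
    have : x <= sup E0 by apply: (ub_le_sup sE.2); left.
    by rewrite in_itv /=; lra.
  rewrite (_ : _ `&` _ = set0) ?rmeas0 //; apply/seteqP; split => x //= [Fx].
  rewrite in_itv /=; have : DB - x <= sup G.
    by apply: (ub_le_sup sG.2); left; rewrite /= (_ : DB - (DB - x) = x) //; lra.
  lra.
have [BD|BD] := ltP (rmeas B) DB; last by exists (sup E0), (sup G); split => //; lra.
have [cG|cG] := leP (sup G) 0.
  have [f Ff|b [c [b1 c1 bcut]]] := critical_cuts_left cr _ BD.
    have : DB - f <= sup G.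
      by apply: (ub_le_sup sG.2); left; rewrite /= (_ : DB - (DB - f) = f) //; lra.
    lra.
  by exists b, c.
have [bE|bE] := leP (sup E0) 0; last by exists (sup E0), (sup G).
have BD' : rmeas (flip_set DB B) < DB by rewrite rmeas_flip.
have [f /flip_holes_right Ef|b [c [b1 c1 bcut]]] := critical_cuts_left (critical_flip cr) _ BD'.
  have : DB - f <= sup E0 by apply: (ub_le_sup sE.2); left.
  lra.
by exists c, b; split => //; exact: cuts_flip.
Qed.

Variables b c : R.
Hypothesis cut : cuts DA DB A B S b c.

Lemma cuts_lt : [/\ 0 <= b, 0 <= c & b + c < DB].
Proof.
have [b0 c0 bc _ _] := cut; split => //; have [_] := critical_measC_lt cr.
by move: bc; rewrite /=; lra.
Qed.

(** [C] consists of [E] and the shifted [F] up to a null set, and [cuts] makes these null beyond [b]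
    and below [DA - c] respectively. *)
Lemma cuts_null Z : measurable Z -> Z `<=` C ->
  (forall x, Z x -> E x -> b < x) -> (forall x, Z x -> F (x - (DA - DB)) -> x < DA - c) ->
  rmeas Z = 0.
Proof.
move=> mZ ZC ZE ZF; have [b0 c0 bc Eb Fc] := cut.
pose N1 : set R := E `&` `]b, DB]; pose N2 : set R := shift_set (DA - DB) (F `&` `[0, DB - c[).
have fN1 : finmeas N1 by rewrite /N1; fmsr.
have fN2 : finmeas N2 by rewrite /N2; fmsr.
have N0 : rmeas (N1 `|` N2) = 0 by apply: rmeas_nullU => //; rewrite rmeas_shift //; msr.
have fN : finmeas (N1 `|` N2) by fmsr.
have fZ : finmeas Z by apply: finmeas_sub mZ (critical_finC cr) ZC.
have := rmeasID fZ fN.1.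
have -> : rmeas (Z `\` (N1 `|` N2)) = 0.
  apply: (critical_null cr); [by msr|by move=> x [/ZC]| |].
    move=> x [Zx nN] Ex; apply: nN; left; split => //=; rewrite in_itv /= ZE //=.
    by have [/= + _] := Ex; rewrite in_itv /=; lra.
  move=> x [Zx nN] Fx; apply: nN; right; split => //=; rewrite in_itv /=.
  by have := ZF _ Zx Fx; have [/= + _] := Fx; rewrite in_itv /=; lra.
have -> : rmeas (Z `&` (N1 `|` N2)) = 0.
  by apply: rmeas_null_sub N0 _ => //; msr.
by rewrite addr0.
Qed.

Lemma cuts_left_stable : rmeas ((S `&` `[0, b]) `\` A) = 0.
Proof.
have [b0 c0 bc] := cuts_lt; apply: cuts_null; [by msr| | |].
- by move=> x [[_ /=]]; rewrite /C /holes /= !in_itv /= => ? nA; split => //; crlra.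
- by move=> x [[Sx _] _] [].
- by move=> x [[_ /=]]; rewrite in_itv /= => ? _ _; crlra.
Qed.

Lemma cuts_right_stable : rmeas ((S `&` `[DA + DB - c, DA + DB]) `\` shift_set DB A) = 0.
Proof.
(* Moved back by [DB], the set becomes a part of [C]. *)
have [b0 c0 bc] := cuts_lt; rewrite -(rmeas_shift (- DB)); last by msr.
apply: cuts_null; [by msr| | |].
- move=> x [[_ /=]]; rewrite /C /holes /shift_set /= opprK addrK !in_itv /= => ? nA.
  by split => //; crlra.
- by move=> x [[_ /=]]; rewrite opprK in_itv /= => ? _ _; crlra.
- move=> x [[Sx _] _] [_] /=; rewrite /shift_set /= opprK.
  by rewrite (_ : x - (DA - DB) + DA = x - - DB); [|lra].
Qed.

Lemma cuts_middle_A : rmeas (`]b, DA - c[ `\` A) = 0.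
Proof.
have [b0 c0 bc] := cuts_lt; apply: cuts_null; [by msr| | |].
- by move=> x [/=]; rewrite /C /holes /= !in_itv /= => ? nA; split => //; crlra.
- by move=> x [/=]; rewrite in_itv /=; lra.
- by move=> x [/=]; rewrite in_itv /=; lra.
Qed.

Lemma cuts_middle_S : rmeas (`]b, DA + DB - c[ `\` S) = 0.
Proof.
have [b0 c0 bc] := cuts_lt; have [_ _ _ Eb Fc] := cut.
pose N1 : set R := E `&` `]b, DB]; pose N2 : set R := shift_set DA (F `&` `[0, DB - c[).
have fN1 : finmeas N1 by rewrite /N1; fmsr.
have fN2 : finmeas N2 by rewrite /N2; fmsr.
have N0 : rmeas (N1 `|` N2) = 0 by apply: rmeas_nullU => //; rewrite rmeas_shift //; msr.
apply: rmeas_null_sub N0 _; [by fmsr|by msr|].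
move=> x [/=]; rewrite in_itv /= => xI nS.
have [xD|xD] := leP x DB.
  by left; split; [split|] => //=; rewrite in_itv /=; lra.
have xA : DA < x by rewrite ltNge; apply/negP => xA; apply: nS; apply: (critical_middle cr); lra.
right; split; [split|] => /=; rewrite ?in_itv /=; [lra| |lra].
by rewrite /shift_set /= opprK subrK.
Qed.

End Structure.

(** * Inner measure *)

Section InnerMeasure.
Variable R : realType.
Implicit Types (X Y Z K N Q : set R) (t x y e : R).

Local Notation mu := (@lebesgue_measure R).

Lemma inner_measE X : finmeas X -> inner_lebesgue X = (rmeas X)%:E.
Proof.
move=> fX; apply/eqP; rewrite eq_le; apply/andP; split.
  apply: ge_ereal_sup => _ [K [cK KX] <-]; have fK := finmeas_compact cK.
  by rewrite (rmeasE fK) lee_fin; apply: rmeas_le => //; case: fK.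
apply/lee_addgt0Pr => e e0; have [K [cK KX Ke]] := rmeas_inner fX e0.
apply: (@le_trans _ _ (mu K + e%:E)%E).
  by rewrite (rmeasE (finmeas_compact cK)) -EFinD lee_fin ltW.
by rewrite leeD2r //; apply: ereal_sup_ubound; exists K.
Qed.

Lemma inner_le X Y : X `<=` Y -> (inner_lebesgue X <= inner_lebesgue Y)%E.
Proof.
move=> XY; apply: ge_ereal_sup => _ [K [cK KX] <-].
by apply: ereal_sup_ubound; exists K => //; split => //; exact: subset_trans XY.
Qed.

Lemma inner_ge0 X : (0 <= inner_lebesgue X)%E.
Proof.
rewrite -[0%E](measure0 mu); apply: ereal_sup_ubound; exists set0 => //.
by split => //; exact: compact0.
Qed.

Lemma compact_shift t K : compact K -> compact (shift_set t K).
Proof.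
move=> cK; have := compact_sumset cK (@compact_set1 _ t).
rewrite (_ : sumset K [set t] = shift_set t K) //; apply/seteqP; split => x /=.
  by case=> a Ka [_ -> <-]; rewrite /shift_set /= addrK.
by move=> Kx; exists (x - t) => //; exists t => //; rewrite subrK.
Qed.

Lemma inner_shift t X : inner_lebesgue (shift_set t X) = inner_lebesgue X.
Proof.
have le s Y : (inner_lebesgue Y <= inner_lebesgue (shift_set s Y))%E.
  apply: ge_ereal_sup => _ [K [cK KY] <-].
  rewrite -(mu_shift s); last exact: compact_measurable.
  apply: ereal_sup_ubound; exists (shift_set s K) => //.
  by split; [exact: compact_shift|move=> x; exact: KY].
apply/eqP; rewrite eq_le le andbT; apply: le_trans (le (- t) _) _.
rewrite (_ : shift_set (- t) _ = X) //.
by apply/seteqP; split => x; rewrite /shift_set /= opprK addrK.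
Qed.

(** For lack of stability under unions, only two rules are available: a measurable null set may be
    absorbed ([inull_absorb]), and a set may be split along a measurable one ([inull_split]). *)
Definition inull Z : Prop := inner_lebesgue Z = 0%E.

Lemma inullP Z : inull Z <-> forall K, compact K -> K `<=` Z -> rmeas K = 0.
Proof.
split=> [Z0 K cK KZ|H].
  apply/eqP; rewrite eq_le rmeas_ge0 andbT -lee_fin -rmeasE; last exact: finmeas_compact.
  by rewrite -[leRHS]Z0; apply: ereal_sup_ubound; exists K.
apply/eqP; rewrite eq_le inner_ge0 andbT; apply: ge_ereal_sup => _ [K [cK KZ] <-].
by rewrite (rmeasE (finmeas_compact cK)) H.
Qed.

Lemma inull_meas Z K : inull Z -> finmeas K -> K `<=` Z -> rmeas K = 0.
Proof.
move=> Z0 fK KZ; apply/eqP; rewrite eq_le rmeas_ge0 andbT -lee_fin -inner_measE //.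
by rewrite -[leRHS]Z0; exact: inner_le.
Qed.

Lemma inull_absorb Y Z N : inull Y -> finmeas N -> rmeas N = 0 -> Z `<=` Y `|` N -> inull Z.
Proof.
move=> Y0 fN N0 ZYN; apply/inullP => K cK KZ; have fK := finmeas_compact cK.
have KN : rmeas (K `&` N) = 0 by apply: (rmeas_null_sub fN) => //; msr.
rewrite (rmeasID fK fN.1) KN add0r.
apply: (inull_meas Y0); first by fmsr.
by move=> x [/KZ/ZYN[]].
Qed.

Lemma inull_sub Y Z : inull Y -> Z `<=` Y -> inull Z.
Proof.
move=> Y0 ZY; apply: (@inull_absorb Y Z set0) => //; last by rewrite setU0.
- by split => //; rewrite measure0.
- exact: rmeas0.
Qed.

Lemma inull_rmeas N : finmeas N -> rmeas N = 0 -> inull N.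
Proof. by move=> fN N0; rewrite /inull inner_measE // N0. Qed.

Lemma inull0 : inull set0.
Proof. by apply: inull_rmeas; [split => //; rewrite measure0|exact: rmeas0]. Qed.

Lemma inull_split Q Z : measurable Q -> inull (Z `&` Q) -> inull (Z `\` Q) -> inull Z.
Proof.
move=> mQ Z1 Z2; apply/inullP => K cK KZ; have fK := finmeas_compact cK.
rewrite (rmeasID fK mQ) (inull_meas Z1) ?(inull_meas Z2) ?addr0 //.
- by fmsr.
- by move=> x [/KZ].
- by fmsr.
- by move=> x [/KZ].
Qed.

Lemma inull_shift t Z : inull Z -> inull (shift_set t Z).
Proof. by rewrite /inull inner_shift. Qed.

Definition core X X0 := [/\ finmeas X0, X0 `<=` X & inner_lebesgue X = (rmeas X0)%:E].

(** A compact part of the difference with positive measure could be added to [X0]. *)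
Lemma core_inull X X0 : core X X0 -> inull (X `\` X0).
Proof.
move=> [f0 X0X XE]; apply/inullP => K cK KX; have fK := finmeas_compact cK.
apply/eqP; rewrite eq_le rmeas_ge0 andbT -(lerD2l (rmeas X0)) addr0 -rmeasU_disj //.
  rewrite -lee_fin -XE -inner_measE; last by fmsr.
  by apply: inner_le => x [/X0X|/KX[]].
by move=> x X0x /KX[].
Qed.

Lemma core_restrict X X0 Q : measurable Q -> core X X0 ->
  inner_lebesgue (X `&` Q) = (rmeas (X0 `&` Q))%:E.
Proof.
move=> mQ co; have [f0 X0X _] := co.
have f0Q : finmeas (X0 `&` Q) by fmsr.
apply/eqP; rewrite eq_le; apply/andP; split; last first.
  by rewrite -inner_measE //; apply: inner_le => x [/X0X].
apply: ge_ereal_sup => _ [K [cK KX] <-]; have fK := finmeas_compact cK.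
rewrite (rmeasE fK) lee_fin; apply: rmeas_null_le => //.
apply: (inull_meas (core_inull co)); first by fmsr.
move=> x [/KX[Xx Qx] nX]; split => // X0x; exact: nX.
Qed.

Lemma inner_bounded X u v : u <= v -> X `<=` `[u, v] ->
  exists2 r, inner_lebesgue X = r%:E & 0 <= r <= v - u.
Proof.
move=> uv Xuv; have fI : finmeas (`[u, v]%classic : set R) by fmsr.
have := inner_le Xuv; rewrite (inner_measE fI) rmeas_itv //.
have := inner_ge0 X; case: (inner_lebesgue X) => [r| |] //=; rewrite ?leye_eq //.
by rewrite !lee_fin => r0 rv; exists r => //; rewrite r0.
Qed.

Definition spans D X :=
  X `<=` `[0, D] /\ forall e, 0 < e -> (exists2 x, X x & x < e) /\ (exists2 x, X x & D - e < x).

(** Unions of compact sets are used so that [measurable_sumset] applies. Each [K n] receives points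
    within [i n] of both ends, so the union still reaches them in the limit. *)
Lemma core_exists D X : 0 <= D -> spans D X ->
  exists K : nat -> set R, [/\ forall n, compact (K n), core X (\bigcup_n K n)
    & spans D (\bigcup_n K n)].
Proof.
move=> D0 [XD Xe]; have [r Xr r0] := inner_bounded D0 XD.
pose i (n : nat) : R := n.+1%:R^-1.
have inv n : 0 < i n by rewrite invr_gt0.
have KP n : exists K : set R, [/\ compact K, K `<=` X, r - i n < rmeas K,
    exists2 x, K x & x < i n & exists2 x, K x & D - i n < x].
  have [_ [K [cK KX] <-]] : exists2 y, [set mu K | K in [set K | compact K /\ K `<=` X]] y
      & ((r - i n)%:E < y)%E.
    apply: ereal_sup_gt; rewrite -/(inner_lebesgue X) Xr lte_fin; have := inv n; lra.
  rewrite (rmeasE (finmeas_compact cK)) lte_fin => Kr.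
  have [[x Xx xn] [y Xy yn]] := Xe _ (inv n).
  have cK' : compact (K `|` ([set x] `|` [set y])).
    by apply: compactU => //; apply: compactU; exact: compact_set1.
  exists (K `|` ([set x] `|` [set y])); split => //.
  - by move=> z [/KX|[->|->]].
  - apply: lt_le_trans Kr _; apply: rmeas_le; [exact: finmeas_compact|exact: compact_measurable|].
    by move=> z; left.
  - by exists x => //; right; left.
  - by exists y => //; right; right.
have [K HK] := choice KP.
exists K; set U := \bigcup_n K n.
have KU n : K n `<=` U by move=> x Kx; exists n.
have UX : U `<=` X by move=> x [n _]; have [_ KX _ _ _] := HK n; exact: KX.
have mU : measurable U.
  by apply: bigcup_measurable => n _; apply: compact_measurable; have [] := HK n.
have fU : finmeas U.
  by apply: finmeas_sub mU _ (subset_trans UX XD); fmsr.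
have small e : 0 < e -> exists n : nat, i n < e.
  move=> e0; exists (Num.truncn e^-1).
  have ei : 0 <= e^-1 by rewrite invr_ge0 ltW.
  by rewrite /i invf_plt ?posrE //; have /andP[] := truncn_itv ei.
split.
- by move=> n; have [] := HK n.
- split => //; apply/eqP; rewrite eq_le; apply/andP; split; last first.
    by rewrite -inner_measE //; exact: inner_le.
  rewrite Xr lee_fin; apply/ler_addgt0Pr => e e0; have [n ne] := small e e0.
  have [cK _ Kr _ _] := HK n.
  have : rmeas (K n) <= rmeas U by apply: rmeas_le => //; exact: compact_measurable.
  lra.
- split; first exact: subset_trans UX XD.
  move=> e e0; have [n ne] := small e e0; have [_ _ _ [x Kx xn] [y Ky yn]] := HK n.
  by split; [exists x|exists y]; [exact: KU Kx|lra|exact: KU Ky|lra].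
Qed.

Lemma sumset_bigcup (K L : nat -> set R) : sumset (\bigcup_n K n) (\bigcup_n L n) =
  \bigcup_i \bigcup_j sumset (K i) (L j).
Proof.
apply/seteqP; split => x.
  by case=> a [i _ Ka] [b [j _ Lb]] <-; exists i => //; exists j => //; exists a => //; exists b.
by case=> i _ [j _ [a Ka [b Lb <-]]]; exists a; [exists i|exists b => //; exists j].
Qed.

Lemma measurable_sumset (K L : nat -> set R) : (forall n, compact (K n)) ->
  (forall n, compact (L n)) -> measurable (sumset (\bigcup_n K n) (\bigcup_n L n)).
Proof.
move=> cK cL; rewrite sumset_bigcup; apply: bigcup_measurable => i _.
by apply: bigcup_measurable => j _; apply: compact_measurable; exact: compact_sumset.
Qed.

(* A compact part of [X] outside [S] and a small translate of it inside [S] would both fit into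
   an open set of less than twice its measure. *)
Lemma shift_limit_null X S : finmeas X -> measurable S ->
  (forall e, 0 < e -> exists2 t, `|t| < e & forall x, X x -> S (x + t)) ->
  rmeas (X `\` S) = 0.
Proof.
move=> fX mS lim; apply/eqP; rewrite eq_le rmeas_ge0 andbT leNgt; apply/negP => pos.
have fY : finmeas (X `\` S) by fmsr.
have [K [cK KY Km]] := rmeas_inner fY pos.
have fK := finmeas_compact cK; have K0 : 0 < rmeas K by move: Km; rewrite ltrDr.
have [U [oU KU fUK Ue]] := rmeas_outer fK K0.
have [d d0 dU] := compact_uniform_nbhs cK oU KU.
have [t td tS] := lim d d0.
have : rmeas K <= rmeas (U `\` K).
  rewrite -(rmeas_shift t (X := K)); last by msr.
  apply: rmeas_le => //; first by msr.
  move=> x; rewrite /shift_set /= => Kx; split.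
    by apply: dU Kx _; rewrite opprB addrC subrK.
  move=> /KY[_]; apply; rewrite -(subrK t x); apply: tS.
  by have [] := KY _ Kx.
lra.
Qed.

(** The slope of [g] is at most one, so the inequality passes from points just below the supremum to
    the supremum. *)
Lemma half_radius_attained D (g : R -> R) (G : R -> \bar R) :
  (forall x y, 0 <= x <= y -> g y - g x <= y - x) ->
  (forall x, 0 <= x <= D -> G x = (g x)%:E) ->
  forall c, c = sup [set x | 0 <= x <= D /\ (G x <= (x / 2)%:E)%E] ->
  0 < c -> c <= D /\ g c <= c / 2.
Proof.
move=> gL Gg c cE c0; set H := [set x | _] in cE.
(* The supremum of the empty set is 0 by convention, which [0 < c] rules out. *)
have [H0|H0] := pselect (H !=set0); last first.
  move: c0; rewrite cE (_ : H = set0) ?sup0 ?ltxx //; apply/seteqP; split => x // Hx.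
  by case: H0; exists x.
have sH : has_sup H by split => //; exists D => x [/andP[]].
split; first by rewrite cE; apply: (ge_sup sH.1) => x [/andP[]].
apply/ler_addgt0Pr => e e0.
have [x [x0 Gx] xe] := sup_adherent e0 sH.
have xc : x <= c by rewrite cE; apply: (ub_le_sup sH.2).
move: Gx; rewrite Gg // lee_fin => gx.
have := gL x c; rewrite -cE in xe; move=> /(_ ltac:(lra)); lra.
Qed.

End InnerMeasure.

(** * Reduction to measurable sets containing their end points *)

Section Reduction.
Variable R : realType.
Implicit Types (A B X Z N : set R) (DA DB b c e t x y : R).

Definition ends D : set R := [set 0] `|` [set D].

Lemma finmeas_ends D : finmeas (ends D).
Proof. by rewrite /ends; fmsr. Qed.

Lemma rmeas_ends D : rmeas (ends D) = 0.
Proof. by apply: rmeas_nullU; rewrite ?rmeas_set1 //; fmsr. Qed.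

(** It isolates the pieces that the end points add to the sumset; [critical_core] shows that each is
    null outside the original one. *)
Lemma sumset_ends A B DA DB : sumset (A `|` ends DA) (B `|` ends DB) =
  sumset A B `|` ((A `|` shift_set DB A) `|` (B `|` shift_set DA B) `|`
    (ends DB `|` shift_set DA (ends DB))).
Proof.
apply/seteqP; split => x.
  case=> a Aa [b Bb <-]; case: Aa => [Aa|[->|->]]; case: Bb => [Bb|[->|->]].
  - by left; exists a => //; exists b.
  - by right; left; left; left; rewrite addr0.
  - by right; left; left; right; rewrite /shift_set /= addrK.
  - by right; left; right; left; rewrite add0r.
  - by right; right; left; left; rewrite addr0.
  - by right; right; left; right; rewrite add0r.
  - by right; left; right; right; rewrite /shift_set /= [DA + _]addrC addrK.
  - by right; right; right; rewrite /shift_set /ends /= [DA + _]addrC addrK; left.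
  - by right; right; right; rewrite /shift_set /ends /= [DA + _]addrC addrK; right.
case=> [[a Aa [b Bb <-]]|[[[]|[]]|[[]|]]].
- by exists a; [left|exists b => //; left].
- by move=> Ax; exists x; [left|exists 0; [right; left|rewrite addr0]].
- by move=> Ax; exists (x - DB); [left|exists DB; [right; right|rewrite subrK]].
- by move=> Bx; exists 0; [right; left|exists x; [left|rewrite add0r]].
- by move=> Bx; exists DA; [right; right|exists (x - DA); [left|rewrite addrC subrK]].
- by move=> ->; exists 0; [right; left|exists 0; [right; left|rewrite add0r]].
- by move=> ->; exists 0; [right; left|exists DB; [right; right|rewrite add0r]].
- move=> Ex; exists DA; [by right; right|exists (x - DA); [by right|by rewrite addrC subrK]].
Qed.

(** The inclusion in A + B only gives m(S0) <= [DB] + m(A0). The converse, which makes [S0] a core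
    of A + B, is the equality in [critical_equality] for [S1]. *)
Lemma critical_core A B DA DB : 0 <= DB -> DB <= DA -> spans DA A -> spans DB B ->
  inner_lebesgue (sumset A B) = (DB%:E + inner_lebesgue A)%E ->
  (DB%:E + inner_lebesgue A < inner_lebesgue A + 2%:E * inner_lebesgue B)%E ->
  exists A0 B0 S0 S1 : set R, [/\ core A A0, core B B0, core (sumset A B) S0,
    finmeas S1 /\ S0 `<=` S1 /\ rmeas (S1 `\` S0) = 0
    & critical DA DB (A0 `|` ends DA) (B0 `|` ends DB) S1].
Proof.
move=> DB0 D spA spB heq hlt; have DA0 : 0 <= DA by lra.
have [K [cK coA spK]] := core_exists DA0 spA.
have [L [cL coB spL]] := core_exists DB0 spB.
set A0 := \bigcup_n K n in coA spK; set B0 := \bigcup_n L n in coB spL.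
pose S0 := sumset A0 B0; pose S1 := sumset (A0 `|` ends DA) (B0 `|` ends DB).
have [fA AA EA] := coA; have [fB BB EB] := coB.
have mS0 : measurable S0 by exact: measurable_sumset.
have fS0 : finmeas S0.
  apply: (finmeas_sub mS0 (finmeas_itv true false 0 (DA + DB))).
  move=> _ [a /spK.1 + [b /spL.1 + <-]]; rewrite /= !in_itv /=; lra.
have fS1 : finmeas S1.
  by rewrite /S1 sumset_ends -/S0; have fe := finmeas_ends DB; fmsr.
have S01 : S0 `<=` S1.
  by move=> _ [a Aa [b Bb <-]]; exists a; [left|exists b => //; left].
(* The points of [A0] and [B0] tend to the ends of the two intervals. *)
have lim X Y s D' : finmeas X -> spans D' Y -> (forall x y, X x -> Y y -> S0 (x + y)) ->
    s = 0 \/ s = D' -> rmeas (shift_set s X `\` S0) = 0.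
  move=> fX [YD Ye] XY sE; apply: shift_limit_null => //; first by fmsr.
  move=> e e0; suff [y Yy ye] : exists2 y, Y y & `|y - s| < e.
    exists (y - s) => // x; rewrite /shift_set /= => Xx.
    by rewrite addrCA addrC; have := XY _ _ Xx Yy; rewrite (_ : x - s + y = y - s + x) //; lra.
  have [[y Yy y1] [z Yz z1]] := Ye e e0.
  have := YD _ Yy; have := YD _ Yz; rewrite /= !in_itv /= => z2 y2.
  by case: sE => ->; [exists y|exists z] => //; rewrite ltr_norml; lra.
have AB x y : A0 x -> B0 y -> S0 (x + y) by move=> Ax By; exists x => //; exists y.
have BA x y : B0 x -> A0 y -> S0 (x + y) by rewrite addrC => Bx Ay; exact: AB.
have shift0 X : shift_set 0 X = X by apply/seteqP; split => x; rewrite /shift_set /= subr0.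
have null : rmeas (S1 `\` S0) = 0.
  pose N : set R := ((A0 `\` S0) `|` (shift_set DB A0 `\` S0)) `|`
    ((B0 `\` S0) `|` (shift_set DA B0 `\` S0)) `|` (ends DB `|` shift_set DA (ends DB)).
  have fe := finmeas_ends DB.
  have fN : finmeas N by rewrite /N; fmsr.
  apply: (rmeas_null_sub fN); first by msr.
    rewrite /N; apply: rmeas_nullU; [by fmsr|by fmsr| |].
      apply: rmeas_nullU; [by fmsr|by fmsr| |]; apply: rmeas_nullU; [by fmsr|by fmsr| | |by fmsr|by fmsr| |].
      - by rewrite -{1}(shift0 A0); apply: lim spL AB _ => //; left.
      - by apply: lim spL AB _ => //; right.
      - by rewrite -{1}(shift0 B0); apply: lim spK BA _ => //; left.
      - by apply: lim spK BA _ => //; right.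
    by apply: rmeas_nullU; rewrite ?rmeas_shift ?rmeas_ends //; fmsr.
  rewrite /S1 sumset_ends -/S0 /N => x [[//|[[[]|[]]|]] Sx nS]; last by right.
  - by left; left; left.
  - by left; left; right.
  - by left; right; left.
  - by left; right; right.
have ABE : inner_lebesgue (sumset A B) = (DB + rmeas A0)%:E by rewrite heq EA EFinD.
have S0AB : S0 `<=` sumset A B.
  by move=> _ [a /AA Aa [b /BB Bb <-]]; exists a => //; exists b.
have S0le : rmeas S0 <= DB + rmeas A0.
  by rewrite -lee_fin -ABE -inner_measE //; exact: inner_le.
have S1E : rmeas S1 = rmeas S0.
  by rewrite (rmeasID fS1 mS0) null addr0 setIidr.
have A1E : rmeas (A0 `|` ends DA) = rmeas A0.
  by apply: rmeas_add_null; rewrite ?rmeas_ends //; exact: finmeas_ends.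
have B1E : rmeas (B0 `|` ends DB) = rmeas B0.
  by apply: rmeas_add_null; rewrite ?rmeas_ends //; exact: finmeas_ends.
have la : DB < 2 * rmeas B0.
  by move: hlt; rewrite EA EB -EFinM -!EFinD lte_fin; lra.
have A1D : A0 `|` ends DA `<=` `[0, DA].
  by move=> x [/spK.1//|[->|->]] /=; rewrite in_itv /=; lra.
have B1D : B0 `|` ends DB `<=` `[0, DB].
  by move=> x [/spL.1//|[->|->]] /=; rewrite in_itv /=; lra.
have cr : critical DA DB (A0 `|` ends DA) (B0 `|` ends DB) S1.
  split => //.
  - by have := finmeas_ends DA; move=> ?; msr.
  - by have := finmeas_ends DB; move=> ?; msr.
  - by msr.
  - by move=> _ [a /A1D + [b /B1D + <-]]; rewrite /= !in_itv /=; lra.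
  - by right; left.
  - by right; right.
  - by right; left.
  - by right; right.
  - by move=> a b Aa Bb; exists a => //; exists b.
  - by rewrite S1E A1E addrC.
  - by rewrite B1E.
exists A0, B0, S0, S1; split => //; split => //.
by rewrite ABE; congr (_%:E); rewrite -S1E (proj1 (critical_equality cr)) A1E addrC.
Qed.

End Reduction.

(** * The theorem for sets in normalized position *)

Section SumsetStructure.
Variable R : realType.
Implicit Types (X Y : set R) (x y t s : R).

Lemma reflect_reflect s t X : reflect_at t (reflect_at s X) = shift_set (t - s) X.
Proof.
rewrite !reflect_atE; apply/seteqP; split => x; rewrite /flip_set /shift_set /=.
  by rewrite (_ : s - (t - x) = x - (t - s)) //; lra.
by rewrite (_ : s - (t - x) = x - (t - s)) //; lra.
Qed.

Variables (DA DB : R) (A B A0 B0 S1 : set R).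
Hypotheses (coA : core A A0) (coB : core B B0).
Hypothesis cr : critical DA DB (A0 `|` ends DA) (B0 `|` ends DB) S1.

(** The end points do not change measures, and [half_radius_attained] supplies the half-density
    hypothesis of [half_density_bound] at the radius itself. *)
Lemma left_half_radius_bound x : 0 < x <= left_half_radius DA A ->
  rmeas (B0 `&` `[0, x]) <= x ^+ 2 / left_half_radius DA A.
Proof.
move=> x0; have [fA AA _] := coA; have [fB _ _] := coB.
have fA1 := critical_finA cr; have fB1 := critical_finB cr; have fe := finmeas_ends DA.
have AE y : inner_lebesgue (A `&` `[0, y]) = (cumul (A0 `|` ends DA) y)%:E.
  rewrite (core_restrict _ coA); last by msr.
  congr (_%:E); apply: (rmeas_eq_null _ _ fe (rmeas_ends DA)); [by fmsr|by fmsr| |].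
    by move=> z [Az zy]; left; split => //; left.
  by move=> z [[Az|ez] zy]; [left|right].
have lip y z : 0 <= y <= z ->
    cumul (A0 `|` ends DA) z - cumul (A0 `|` ends DA) y <= z - y.
  by move=> yz; have /andP[] := cumul_lip fA1 yz.
have c0 : 0 < left_half_radius DA A by lra.
have [cD Ac] := half_radius_attained lip (fun y _ => AE y) (erefl (left_half_radius DA A)) c0.
apply: le_trans (half_density_bound cr c0 cD Ac x0).
by apply: rmeas_le; [fmsr|msr|move=> z [Bz zx]; split => //; left].
Qed.

Lemma right_half_radius_bound x : 0 < x <= right_half_radius DA A ->
  rmeas (flip_set DB B0 `&` `[0, x]) <= x ^+ 2 / right_half_radius DA A.
Proof.
move=> x0; have [fA AA _] := coA; have [fB _ _] := coB.
have cr' := critical_flip cr; have fA1 := critical_finA cr'; have fB1 := critical_finB cr'.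
have AE y : 0 <= y <= DA ->
    inner_lebesgue (A `&` `]DA - y, DA[) = (cumul (flip_set DA (A0 `|` ends DA)) y)%:E.
  move=> y0; rewrite (core_restrict _ coA); last by msr.
  rewrite /cumul -(rmeas_flip DA); last by msr.
  (* The radius is defined with an open window and [cumul] with a closed one; the two differ at most
     in these points. *)
  pose N : set R := ends DA `|` [set y].
  have fN : finmeas N by have := finmeas_ends DA; rewrite /N => ?; fmsr.
  have N0 : rmeas N = 0.
    by apply: rmeas_nullU; rewrite ?rmeas_ends ?rmeas_set1 //; [exact: finmeas_ends|fmsr].
  congr (_%:E); apply: (rmeas_eq_null _ _ fN N0); [by fmsr|by fmsr| |].
    move=> z [Az] /=; rewrite in_itv /= => zy; left; split; first by left.
    by rewrite /= in_itv /=; lra.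
  move=> z [Az] /=; rewrite in_itv /= => zy.
  have [->|zn0] := eqVneq z 0; first by right; left; left.
  have [->|zny] := eqVneq z y; first by right; right.
  have zI : 0 < z < y by rewrite !lt_neqAle eq_sym zn0 zny; lra.
  case: Az => [Az|[]]; rewrite /flip_set /=.
  - by left; split => //=; rewrite in_itv /=; lra.
  - by move=> Dz; right; left; right; rewrite /=; lra.
  - by move=> Dz; right; left; left; rewrite /=; lra.
have lip y z : 0 <= y <= z ->
    cumul (flip_set DA (A0 `|` ends DA)) z - cumul (flip_set DA (A0 `|` ends DA)) y <= z - y.
  by move=> yz; have /andP[] := cumul_lip fA1 yz.
have c0 : 0 < right_half_radius DA A by lra.
have [cD Ac] := half_radius_attained lip AE (erefl (right_half_radius DA A)) c0.
apply: le_trans (half_density_bound cr' c0 cD Ac x0).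
by apply: rmeas_le; [fmsr|msr|move=> z [Bz zx]; split => //; left].
Qed.

End SumsetStructure.

Lemma sumset_structure (R : realType) (A B : set R) (DA DB : R) : 0 <= DB -> DB <= DA ->
  spans DA A -> spans DB B ->
  inner_lebesgue (sumset A B) = (DB%:E + inner_lebesgue A)%E ->
  (DB%:E + inner_lebesgue A < inner_lebesgue A + 2%:E * inner_lebesgue B)%E ->
  let AB := sumset A B in
  exists b c : R,
    [/\ (0 <= b <= DB) /\ (0 <= c <= DB),
        (inner_lebesgue B < DB%:E)%E -> 0 < b /\ 0 < c,
        (inner_lebesgue A + inner_lebesgue B - DB%:E <= (DA - c - b)%:E)%E &
    let I : set R := (`]b, DA - c[)%classic in
    let A1 := A `&` `[0, b] in
    let A2 := reflect_at DA (A `&` `[DA - c, DA]) in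
    [/\ null_eq (A `&` `[0, b]) (AB `&` `[0, b]),
        null_eq (AB `&` `[DA + DB - c, DA + DB]) (reflect_at (DA + DB) A2),
        null_sub I A,
        null_sub (`]b, DA + DB - c[)%classic AB &
        null_eq A (A1 `|` I `|` reflect_at DA A2) /\
        null_eq AB (A1 `|` (`]b, DA + DB - c[)%classic `|` reflect_at (DA + DB) A2)] /\
    exists B1 BI B2 : set R,
    [/\ null_eq B (B1 `|` BI `|` reflect_at DB B2),
        [/\ B1 `&` BI = set0, B1 `&` reflect_at DB B2 = set0 &
            BI `&` reflect_at DB B2 = set0],
        [/\ B1 `<=` A1, B2 `<=` A2 & BI `<=` (`]b, DB - c[)%classic],
        (let c1 := left_half_radius DA A in
         forall x : R, 0 < x <= c1 ->
           (inner_lebesgue (B1 `&` `[0%R, x]) <= (x ^+ 2 / c1)%:E)%E) &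
        (let c2 := right_half_radius DA A in
         forall x : R, 0 < x <= c2 ->
           (inner_lebesgue (B2 `&` `[0%R, x]) <= (x ^+ 2 / c2)%:E)%E)] ].
Proof.
move=> DB0 D spA spB heq hlt AB.
have [A0 [B0 [S0 [S1 [coA coB coS [fS1 [S01 NS0]] cr]]]]] :=
  critical_core DB0 D spA spB heq hlt.
have [fA AA EA] := coA; have [fB BB EB] := coB; have [fS SS _] := coS.
have iA := core_inull coA; have iB := core_inull coB; have iS := core_inull coS.
have feA := finmeas_ends DA; have feB := finmeas_ends DB.
have fA1 := critical_finA cr; have fB1 := critical_finB cr.
have A1E : rmeas (A0 `|` ends DA) = rmeas A0 by apply: rmeas_add_null; rewrite ?rmeas_ends.
have B1E : rmeas (B0 `|` ends DB) = rmeas B0 by apply: rmeas_add_null; rewrite ?rmeas_ends.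
have [b [c [cut bpos]]] := critical_cuts cr.
have [b0 c0 bcD] := cuts_lt cr cut; have [_ _ bcM _ _] := cut.
exists b, c.
rewrite EA EB; split; [by split; lra| | |].
- by rewrite lte_fin -B1E; exact: bpos.
- rewrite -!EFinD lee_fin; move: bcM.
  by rewrite /= (critical_measC cr) A1E B1E; lra.
move=> I A1 A2.
have A2r : reflect_at DA A2 = A `&` `[DA - c, DA].
  by rewrite /A2 reflect_reflect subrr; apply/seteqP; split => x; rewrite /shift_set /= subr0.
have A2s : reflect_at (DA + DB) A2 = shift_set DB (A `&` `[DA - c, DA]).
  by rewrite /A2 reflect_reflect addrAC subrr add0r.
rewrite A2r A2s; set T := shift_set DB _.
pose J : set R := `]b, DA + DB - c[%classic.
pose top : set R := `[DA + DB - c, DA + DB]%classic.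
have mtop : measurable top by exact: measurable_itv.
have topT : T `<=` top.
  by move=> x [_] /=; rewrite /top /= !in_itv /=; lra.
(* These exceptional sets are measurable and null, so they can be absorbed into the inner null
   differences between [A], [B], [AB] and their cores. *)
pose N1 : set R := (S1 `&` `[0, b]) `\` A0.
pose N2 : set R := (S1 `&` top) `\` shift_set DB A0.
pose NS : set R := S1 `\` S0.
pose N3 : set R := I `\` A0.
pose N4 : set R := J `\` S0.
have fI : finmeas I by rewrite /I; fmsr.
have fJ : finmeas J by rewrite /J; fmsr.
have fN1 : finmeas N1 by rewrite /N1; fmsr.
have fN2 : finmeas N2 by rewrite /N2; fmsr.
have fNS : finmeas NS by rewrite /NS; fmsr.
have fN3 : finmeas N3 by rewrite /N3; fmsr.
have fN4 : finmeas N4 by rewrite /N4; fmsr.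
have mA1 : measurable (A0 `|` ends DA) by msr.
have N10 : rmeas N1 = 0.
  apply: (@rmeas_null_sub _ (((S1 `&` `[0, b]) `\` (A0 `|` ends DA)) `|` ends DA)); [by fmsr|by msr| |].
    by apply: rmeas_nullU; rewrite ?rmeas_ends //; [fmsr|exact: (cuts_left_stable cr cut)].
  move=> x [Sx nA]; have [ex|ex] := pselect (ends DA x); [by right|left].
  by split => // -[].
have N20 : rmeas N2 = 0.
  apply: (@rmeas_null_sub _ (((S1 `&` top) `\` shift_set DB (A0 `|` ends DA)) `|`
      shift_set DB (ends DA))); [by fmsr|by msr| |].
    apply: rmeas_nullU; [by fmsr|by fmsr|exact: (cuts_right_stable cr cut)|].
    by rewrite rmeas_shift ?rmeas_ends //; msr.
  move=> x [Sx nA]; have [ex|ex] := pselect (ends DA (x - DB)); [by right|left].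
  by split => // -[].
have N30 : rmeas N3 = 0.
  apply: (@rmeas_null_sub _ ((I `\` (A0 `|` ends DA)) `|` ends DA)); [by fmsr|by msr| |].
    by apply: rmeas_nullU; rewrite ?rmeas_ends //; [fmsr|exact: (cuts_middle_A cr cut)].
  move=> x [Sx nA]; have [ex|ex] := pselect (ends DA x); [by right|left].
  by split => // -[].
have N40 : rmeas N4 = 0.
  apply: (@rmeas_null_sub _ ((J `\` S1) `|` NS)); [by fmsr|by msr| |].
    by apply: rmeas_nullU => //; [fmsr|exact: (cuts_middle_S cr cut)].
  by move=> x [Jx nS]; have [Sx|nS1] := pselect (S1 x); [right|left].
have A0S x : A0 x -> S1 x.
  by move=> Ax; rewrite -[x]addr0; apply: (crit_sum cr _ (crit_B0 cr)); left.
have A0DS x : A0 (x - DB) -> S1 x.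
  by move=> Ax; rewrite -(subrK DB x); apply: (crit_sum cr _ (crit_BD cr)); left.
have B0S x : B0 x -> S1 x by move=> Bx; apply: (critical_BS cr); left.
have B0DS x : B0 x -> S1 (x + DA).
  by move=> Bx; rewrite addrC; apply: (crit_sum cr (crit_AD cr)); left.
have A_AB : inull (A1 `\` AB).
  apply: (inull_absorb iA fNS NS0) => x [[Ax _] nAB].
  have [A0x|nA] := pselect (A0 x); [right|by left]; split; [exact: A0S|by move=> /SS].
have T_AB : inull (T `\` AB).
  apply: (inull_absorb (inull_shift DB iA) fNS NS0) => x [[Ax _] nAB].
  have [A0x|nA] := pselect (A0 (x - DB)); [right|by left]; split; [exact: A0DS|by move=> /SS].
have J_AB : inull (J `\` AB).
  by apply: (inull_sub (inull_rmeas fN4 N40)) => x [Jx nAB]; split => // /SS.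
have I_A : inull (I `\` A).
  by apply: (inull_sub (inull_rmeas fN3 N30)) => x [Ix nA]; split => // /AA.
have ABD : AB `<=` `[0, DA + DB].
  by move=> _ [a /spA.1 + [b' /spB.1 + <-]]; rewrite /= !in_itv /=; lra.
have sd0 X Y : X `<=` Y -> null_sub X Y.
  by move=> XY; rewrite /null_sub (_ : X `\` Y = set0); [exact: inull0|rewrite setD_eq0].
split.
  split; [split|split| | |split; split].
  - by apply: (inull_sub A_AB) => x [[Ax xb] nAB]; split => // ABx; apply: nAB.
  - apply: (inull_absorb iS fN1 N10) => x [[ABx xb] nA].
    have [Sx|nS] := pselect (S0 x); [right|by left].
    by split; [split => //; exact: S01|move=> /AA Ax; apply: nA].
  - apply: (inull_absorb iS fN2 N20) => x [[ABx xt] nT].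
    have [Sx|nS] := pselect (S0 x); [right|by left].
    split; [by split => //; exact: S01|move=> /AA Ax; apply: nT; split => //].
    by move: xt; rewrite /= !in_itv /=; lra.
  - apply: (inull_sub T_AB) => x [Tx nAB]; split => // ABx; apply: nAB.
    by split => //; exact: topT.
  - exact: I_A.
  - exact: J_AB.
  - apply: sd0 => x Ax; have := spA.1 _ Ax; rewrite /= in_itv /= => x0.
    have [xb|xb] := leP x b; first by left; left; split => //=; rewrite in_itv /=; lra.
    have [xc|xc] := ltP x (DA - c); first by left; right; rewrite /I /= in_itv /=; lra.
    by right; split => //=; rewrite in_itv /=; lra.
  - by apply: (inull_sub I_A) => x [[[[//]|Ix]|[//]] nA].
  - have N120 : rmeas (N1 `|` N2) = 0 by exact: rmeas_nullU.
    apply: (inull_absorb iS (finmeasU fN1 fN2) N120) => x [ABx nU].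
    have [Sx|nS] := pselect (S0 x); [right|by left].
    have := ABD _ ABx; rewrite /= in_itv /= => x0.
    have [xb|xb] := leP x b.
      left; split; first by split; [exact: S01|rewrite /= in_itv /=; lra].
      by move=> /AA Ax; apply: nU; left; left; split => //=; rewrite in_itv /=; lra.
    have [xc|xc] := ltP x (DA + DB - c).
      by case: nU; left; right; rewrite /= in_itv /=; lra.
    right; split; first by split; [exact: S01|rewrite /top /= in_itv /=; lra].
    move=> /AA Ax; apply: nU; right; split => //=; rewrite in_itv /=; lra.
  (* [A1] and [T] each exceed [AB] by a merely inner null set. The measurable set [[0, b]] separates
     the two, so they need not be united. *)
  - apply: (@inull_split _ `[0, b]%classic); first exact: measurable_itv.
      apply: (inull_sub A_AB) => x [[[[Ax|Jx]|/topT Tx] nAB]] /=; rewrite in_itv /= => xb.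
      + by [].
      + by move: Jx; rewrite /= in_itv /=; lra.
      + by move: Tx; rewrite /top /= in_itv /=; lra.
    apply: (inull_absorb T_AB fN4 N40) => x [[[[[_ Ax]|Jx]|Tx] nAB]] nb //.
    + by right; split => // /SS.
    + by left.
(* The inclusions in [A1] and [A2] have to be exact, hence the intersections with [A0]. They cost a
   null set only: [B0] and its translate by [DA] lie in [S1], so the loss is in [N1] and in a shift
   of [N2]. *)
pose B1 : set R := B0 `&` A0 `&` `[0, b].
pose BI : set R := B0 `&` `]b, DB - c[.
pose B3 : set R := B0 `&` shift_set (DB - DA) A0 `&` `[DB - c, DB].
pose B2 : set R := flip_set DB B3.
have B23 : reflect_at DB B2 = B3.
  rewrite /B2 -reflect_atE reflect_reflect subrr.
  by apply/seteqP; split => x; rewrite /shift_set /= subr0.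
have fB1' : finmeas B1 by rewrite /B1; fmsr.
have fB3 : finmeas B3 by rewrite /B3; fmsr.
exists B1, BI, B2; rewrite B23; split.
- split; last first.
    by apply: sd0 => x [[[[/BB]]|[/BB]]|[[/BB]]].
  pose N2' : set R := shift_set (- DA) N2.
  have fN2' : finmeas N2' by rewrite /N2'; fmsr.
  have N120 : rmeas (N1 `|` N2') = 0.
    by apply: rmeas_nullU => //; rewrite rmeas_shift //; msr.
  apply: (inull_absorb iB (finmeasU fN1 fN2') N120) => x [Bx nU].
  have [B0x|nB] := pselect (B0 x); [right|by left].
  have := spB.1 _ Bx; rewrite /= in_itv /= => x0.
  have [xb|xb] := leP x b.
    left; split; first by split; [exact: B0S|rewrite /= in_itv /=; lra].
    by move=> Ax; apply: nU; left; left; split => //=; rewrite in_itv /=; lra.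
  have [xc|xc] := ltP x (DB - c).
    by case: nU; left; right; split => //=; rewrite in_itv /=; lra.
  right; rewrite /N2' /shift_set /= opprK; split.
    by split; [exact: B0DS|rewrite /top /= in_itv /=; lra].
  rewrite /shift_set /= => Ax; apply: nU; right; split; last by rewrite /= in_itv /=; lra.
  by split => //; rewrite /shift_set /= (_ : x - (DB - DA) = x + DA - DB) //; lra.
- split; apply/seteqP; split => x //=.
  + by move=> [[_ /=] + [_ /=]]; rewrite !in_itv /=; lra.
  + by move=> [[_ /=] + [_ /=]]; rewrite !in_itv /=; lra.
  + by move=> [[_ /=] + [_ /=]]; rewrite !in_itv /=; lra.
- split.
  + by move=> x [[_ /AA Ax] xb].
  + move=> x [[_ /AA /=]]; rewrite in_itv /= /A2 reflect_atE /flip_set /shift_set /= => Ax xb.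
    move: Ax; rewrite (_ : DB - x - (DB - DA) = DA - x); last by lra.
    by move=> Ax; split => //=; rewrite in_itv /=; lra.
  + by move=> x [].
- move=> c1 x x0; rewrite inner_measE; last by fmsr.
  rewrite lee_fin; apply: le_trans (left_half_radius_bound coA coB cr x0).
  by apply: rmeas_le; [fmsr|msr|move=> y [[[By _] _] yx]].
- move=> c2 x x0; rewrite inner_measE; last by rewrite /B2; fmsr.
  rewrite lee_fin; apply: le_trans (right_half_radius_bound coA coB cr x0).
  by apply: rmeas_le; [fmsr|rewrite /B2; msr|move=> y [[[By _] _] yx]].
Qed.

(** * Translation to normalized position *)

Section Normalization.
Variable R : realType.
Implicit Types X : set R.

Lemma bounded_has_sup_inf X : bounded_set X -> X !=set0 -> has_sup X /\ has_inf X.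
Proof.
move=> [M [_ MX]] X0; have {}MX x : X x -> `|x| <= M + 1 by apply: MX; rewrite ltrDl.
by split; split => //; [exists (M + 1)|exists (- (M + 1))] => x /MX; rewrite ler_norml => /andP[].
Qed.

Lemma spans_translate X : has_sup X -> has_inf X -> spans (diam X) (translate (- inf X) X).
Proof.
move=> sX iX; rewrite translateE /shift_set /diam; split=> [x|e e0] /=.
  by rewrite opprK in_itv /= => Xx; have := ub_le_sup sX.2 Xx; have := ge_inf iX.2 Xx; lra.
split.
  have [x Xx xe] := inf_adherent e0 iX; exists (x - inf X); last by lra.
  by rewrite (_ : x - inf X - - inf X = x) //; lra.
have [x Xx xe] := sup_adherent e0 sX; exists (x - inf X); last by lra.
by rewrite (_ : x - inf X - - inf X = x) //; lra.
Qed.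

Lemma inner_translate X t : inner_lebesgue (translate t X) = inner_lebesgue X.
Proof. by rewrite translateE inner_shift. Qed.

End Normalization.

Theorem theorem1p3 (R : realType) (A B : set R)
  (hA : bounded_set A) (hB : bounded_set B) (hD : diam B <= diam A)
  (heq : inner_lebesgue (sumset A B) = ((diam B)%:E + inner_lebesgue A)%E)
  (hlt : ((diam B)%:E + inner_lebesgue A
            < inner_lebesgue A + 2%:E * inner_lebesgue B)%E) :
  let DA := diam A in
  let DB := diam B in
  let A' := translate (- inf A) A in
  let B' := translate (- inf B) B in
  let AB := sumset A' B' in
  exists b c : R,
    [/\ (0 <= b <= DB) /\ (0 <= c <= DB),
        (inner_lebesgue B < DB%:E)%E -> 0 < b /\ 0 < c,
        (inner_lebesgue A + inner_lebesgue B - DB%:E <= (DA - c - b)%:E)%E &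
    let I : set R := (`]b, DA - c[)%classic in
    let A1 := A' `&` `[0, b] in
    let A2 := reflect_at DA (A' `&` `[DA - c, DA]) in
    [/\ null_eq (A' `&` `[0, b]) (AB `&` `[0, b]),
        null_eq (AB `&` `[DA + DB - c, DA + DB]) (reflect_at (DA + DB) A2),
        null_sub I A',
        null_sub (`]b, DA + DB - c[)%classic AB &
        null_eq A' (A1 `|` I `|` reflect_at DA A2) /\
        null_eq AB (A1 `|` (`]b, DA + DB - c[)%classic `|` reflect_at (DA + DB) A2)] /\
    exists B1 BI B2 : set R,
    [/\ null_eq B' (B1 `|` BI `|` reflect_at DB B2),
        [/\ B1 `&` BI = set0, B1 `&` reflect_at DB B2 = set0 &
            BI `&` reflect_at DB B2 = set0],
        [/\ B1 `<=` A1, B2 `<=` A2 & BI `<=` (`]b, DB - c[)%classic],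
        (let c1 := left_half_radius DA A' in
         forall x : R, 0 < x <= c1 ->
           (inner_lebesgue (B1 `&` `[0%R, x]) <= (x ^+ 2 / c1)%:E)%E) &
        (let c2 := right_half_radius DA A' in
         forall x : R, 0 < x <= c2 ->
           (inner_lebesgue (B2 `&` `[0%R, x]) <= (x ^+ 2 / c2)%:E)%E)] ].
Proof.
move=> DA DB A' B' AB.
have inner0 : inner_lebesgue (set0 : set R) = 0%E by exact: inull0.
have diam0 : diam (set0 : set R) = 0 by rewrite /diam sup0 inf0 subrr.
(* With the convention that the empty set has supremum and infimum 0, an empty [B] turns [hlt] into
   a strict inequality between equal terms. *)
have B0 : B !=set0.
  apply/set0P/negP => /eqP BE; move: hlt.
  by rewrite BE inner0 mule0 adde0 diam0 add0e ltxx.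
have [sB iB] := bounded_has_sup_inf hB B0.
have DB0 : 0 <= DB.
  by have [x Bx] := B0; rewrite /DB /diam; have := ub_le_sup sB.2 Bx; have := ge_inf iB.2 Bx; lra.
have spB := spans_translate sB iB.
(* For empty [A] the diameter of [B] is at most 0, so [B] has measure 0 and [hlt] reads 0 < 0. *)
have A0 : A !=set0.
  apply/set0P/negP => /eqP AE; move: hlt hD; rewrite AE inner0 diam0 adde0 add0e => hlt DB'.
  have [r Br r0] := inner_bounded DB0 spB.1.
  by move: hlt; rewrite -(inner_translate B (- inf B)) Br -EFinM lte_fin -/DB; move: DB'; rewrite -/DB; lra.
have [sA iA] := bounded_has_sup_inf hA A0.
have spA := spans_translate sA iA.
have ABE : AB = translate (- (inf A + inf B)) (sumset A B).
  rewrite /AB /A' /B'; apply/seteqP; split => x.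
    case=> _ [a Aa <-] [_ [b Bb <-] <-]; exists (a + b); last by lra.
    by exists a => //; exists b.
  case=> _ [a Aa [b Bb <-]] <-; exists (- inf A + a); first by exists a.
  by exists (- inf B + b); [exists b|lra].
have heq' : inner_lebesgue AB = (DB%:E + inner_lebesgue A')%E by rewrite ABE !inner_translate.
have hlt' : (DB%:E + inner_lebesgue A' < inner_lebesgue A' + 2%:E * inner_lebesgue B')%E.
  by rewrite !inner_translate.
have := sumset_structure DB0 hD spA spB heq' hlt'.
by rewrite !inner_translate.
Qed.
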